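(* There is an algorithm that, given a CNF $\psi$, a set $X\subseteq\mathrm{vars}(\psi)$, and a tree decomposition of width $k$ of the primal graph $G_\psi$, outputs in time $O^*(2^k)$ a CNF $\psi'$ and a tree decomposition of width $12\cdot 2^k$ of $G_{\psi'}$ such that the projected model count of $\psi$ on $X$ equals $\#(\psi')$, the number of satisfying assignments of $\psi'$.
   Context: The projected model count of $\psi$ on $X\subseteq\mathrm{vars}(\psi)$ is the number of assignments of $X$ that can be extended to a satisfying assignment of $\psi$ on all of $\mathrm{vars}(\psi)$. The primal graph $G_\psi$ of a CNF has vertex set $\mathrm{vars}(\psi)$ and an edge between two variables occurring together in a clause. The width of a tree decomposition is the maximum bag size minus one. $O^*(\cdot)$ hides factors polynomial in the input size. *)

(* Defs.v *)
From HB Require Import structures.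
From mathcomp Require Import all_boot all_order all_algebra.

Set Implicit Arguments.
Unset Strict Implicit.
Unset Printing Implicit Defensive.

(* Variable names are finite binary words, so that the length of a name
   contributes to the size of the input. *)
Notation var := (seq bool).

(* (true, x) is the literal x and (false, x) is its negation. *)
Definition literal : Type := (bool * var)%type.
Definition clause : Type := seq literal.
Definition cnf : Type := seq clause.

Definition clause_vars (C : clause) : seq var := map snd C.
Definition vars (psi : cnf) : seq var := undup (flatten (map clause_vars psi)).

(* As elsewhere in this file, a finite set of variables is given by a list, in
   which order and repetitions are irrelevant; seq_sub X is the finite type of
   the elements of X. *)
Definition assignment (X : seq var) := {ffun seq_sub X -> bool}.

(* The default value is never used below: values are only taken at elements
   of X. *)
Definition value (X : seq var) (a : assignment X) (x : var) : bool :=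
  if insub x is Some u then a u else false.

Definition satisfies (X : seq var) (a : assignment X) (psi : cnf) : bool :=
  all (fun C : clause => has (fun l : literal => value a l.2 == l.1) C) psi.

Definition extends (X Y : seq var) (b : assignment Y) (a : assignment X) : bool :=
  [forall x : seq_sub X, value b (val x) == a x].

Definition model_count (psi : cnf) : nat :=
  #|[set b : assignment (vars psi) | satisfies b psi]|.

Definition projected_model_count (psi : cnf) (X : seq var) : nat :=
  #|[set a : assignment X |
      [exists b : assignment (vars psi), extends b a && satisfies b psi]]|.

Definition primal_edge (psi : cnf) : rel var := fun x y =>
  (x != y) && has (fun C => (x \in clause_vars C) && (y \in clause_vars C)) psi.

(* A tree whose nodes carry bags, rooted at an arbitrary node. *)
Inductive bag_tree : Type := BagNode of seq var & seq bag_tree.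

Fixpoint bags (T : bag_tree) : seq (seq var) :=
  let: BagNode B ts := T in B :: flatten (map bags ts).

(* A node is addressed by the child indices on the path from the root to it.
   The bag at an address that does not exist in T is empty. *)
Fixpoint bag_at (T : bag_tree) (p : seq nat) : seq var :=
  let: BagNode B ts := T in
  if p is i :: p' then bag_at (nth (BagNode [::] [::]) ts i) p' else B.

Definition is_child (p q : seq nat) : bool :=
  (q != [::]) && (p == take (size q).-1 q).

Definition node_adj : rel (seq nat) := fun p q => is_child p q || is_child q p.

(* The nodes of T whose bag contains v induce a connected subgraph of T. *)
Definition bags_connected (T : bag_tree) (v : var) : Prop :=
  forall p q : seq nat, v \in bag_at T p -> v \in bag_at T q ->
  exists s : seq (seq nat),
    [/\ path node_adj p s, last p s = q & all (fun r => v \in bag_at T r) s].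

Definition tree_decomposition (V : seq var) (E : rel var) (T : bag_tree) : Prop :=
  [/\ forall B, B \in bags T -> {subset B <= V},
      forall v, v \in V -> exists2 B, B \in bags T & v \in B,
      forall u v, u \in V -> v \in V -> E u v ->
        exists2 B, B \in bags T & (u \in B) && (v \in B)
    & forall v, v \in V -> bags_connected T v].

(* An integer, since the width is -1 when all bags are empty. *)
Definition width (T : bag_tree) : int :=
  ((\max_(B <- bags T) size (undup B))%:Z - 1)%R.

(* Data are binary trees, as in pure Lisp. *)
Inductive data : Type := Nil | Pair of data & data.

Fixpoint dsize (x : data) : nat :=
  if x is Pair y z then (dsize y + dsize z).+1 else 1.

(* First-order call-by-value recursive programs.  Variables are de Bruijn
   indices.  In [ECase e e0 e1], e1 is evaluated if the value of e is a pair; it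
   then binds the head (index 0) and the tail (index 1) of that pair. *)
Inductive expr : Type :=
  | EVar of nat
  | ENil
  | EPair of expr & expr
  | ECase of expr & expr & expr
  | ELet of expr & expr
  | ECall of nat & expr.

(* The bodies of unary functions, which may call each other by index; the
   function of index 0 is the main one. *)
Definition program : Type := seq expr.

(* [eval P env e v t]: e evaluates to v in environment env in t steps.  Every
   step is a constant number of pointer operations on a heap of shared cells:
   there is no operation, such as an equality test, that inspects a whole
   value. *)
Inductive eval (P : program) : seq data -> expr -> data -> nat -> Prop :=
  | eval_var env i : eval P env (EVar i) (nth Nil env i) 1
  | eval_nil env : eval P env ENil Nil 1
  | eval_pair env e1 e2 v1 v2 t1 t2 :
      eval P env e1 v1 t1 -> eval P env e2 v2 t2 ->
      eval P env (EPair e1 e2) (Pair v1 v2) (t1 + t2).+1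
  | eval_case_nil env e e0 e1 v t t' :
      eval P env e Nil t -> eval P env e0 v t' ->
      eval P env (ECase e e0 e1) v (t + t').+1
  | eval_case_pair env e e0 e1 x y v t t' :
      eval P env e (Pair x y) t -> eval P (x :: y :: env) e1 v t' ->
      eval P env (ECase e e0 e1) v (t + t').+1
  | eval_let env e e' u v t t' :
      eval P env e u t -> eval P (u :: env) e' v t' ->
      eval P env (ELet e e') v (t + t').+1
  | eval_call env f e u v t t' :
      eval P env e u t -> eval P [:: u] (nth ENil P f) v t' ->
      eval P env (ECall f e) v (t + t').+1.

Lemma eval_deterministic (P : program) env e v t v' t' :
  eval P env e v t -> eval P env e v' t' -> v = v' /\ t = t'.
Proof.
move=> H; move: v' t'; elim: H => {env e v t}; intros;
  match goal with
  | |- ?v = ?w /\ ?t = ?u =>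
      match goal with K : eval _ _ _ w u |- _ => inversion K; subst; clear K end
  end;
  repeat match goal with
  | IH : forall v t, eval _ ?env ?e v t -> _, K : eval _ ?env ?e _ _ |- _ =>
      destruct (IH _ _ K) as [Ev Et]; clear K; try discriminate Ev;
      try (injection Ev; clear Ev; intros); subst
  end; by [].
Qed.

(* Writing down the output is charged by its size: because of sharing, t steps
   can build a value of size exponential in t. *)
Definition outputs_within (P : program) (x y : data) (t : nat) : Prop :=
  exists2 s, eval P [:: x] (nth ENil P 0) y s & s + dsize y <= t.

Definition enc_seq (A : Type) (enc : A -> data) (s : seq A) : data :=
  foldr (fun x d => Pair (enc x) d) Nil s.

Definition enc_bool (b : bool) : data := if b then Pair Nil Nil else Nil.

Definition enc_var (x : var) : data := enc_seq enc_bool x.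

Definition enc_literal (l : literal) : data := Pair (enc_bool l.1) (enc_var l.2).

Definition enc_cnf (psi : cnf) : data := enc_seq (enc_seq enc_literal) psi.

Fixpoint enc_bag_tree (T : bag_tree) : data :=
  let: BagNode B ts := T in
  Pair (enc_seq enc_var B) (enc_seq enc_bag_tree ts).

Definition enc_input (psi : cnf) (X : seq var) (T : bag_tree) : data :=
  Pair (enc_cnf psi) (Pair (enc_seq enc_var X) (enc_bag_tree T)).

Definition enc_output (psi : cnf) (T : bag_tree) : data :=
  Pair (enc_cnf psi) (enc_bag_tree T).

(* Main.v *)
From mathcomp Require Import all_boot all_order all_algebra.
From mathcomp Require Import zify.
Require Import Defs.

(* Run the usual dynamic programming over the tree decomposition, but write it
   down as a Boolean circuit instead of evaluating it.  For a node with bag B and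
   an assignment a of B there is a gate that says whether a extends to the
   variables below the node so that no clause inside a bag is falsified and the
   variables of X get the values of the circuit inputs.  Passing to a child keeps
   the variables of the common part of the two bags and eliminates the fresh
   variables of the child one at a time: by a disjunction if the variable is
   existential, by a multiplexer controlled by the input if it is in X.  Each
   node thus contributes O(2^|B|) gates, and the gates that share a clause live
   at one node, so the tree itself, with the local gates as bags, is a tree
   decomposition of the Tseitin encoding.  The inputs determine all gates, hence
   the models of the encoding with output gate 1 are the assignments of X that
   extend to a model of psi: by the Helly property of subtrees every clause lies
   in some bag, and by connectedness the local choices glue. *)

(** A node with many children is the obstacle: joining all of them at once would need either a gate
    of unbounded fan-in or a bag with the gates of every child. The tree is therefore read as a
    binary one, in which a node joins the first child of a bag with the remaining children of the
    same bag; its gates then touch only the two neighbouring families of gates. An empty bag is put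
    above the input tree. The root thereby becomes an ordinary child, and the verdict on the whole
    formula is a single gate with the empty name. Existential variables must not survive in the
    output, since several extensions of one projected assignment would then be counted separately.
    Only inputs and gates are left, and the gates are functions of the inputs. Names of gates grow
    at the front of a word, so that a new name shares the old one and costs a constant number of
    steps. Writing names down is charged in full, however, which is why the size of the output is
    bounded separately from the running time. *)

Set Implicit Arguments.
Unset Strict Implicit.
Unset Printing Implicit Defensive.

(** * Programs *)

(* Higher-order syntax: variables are de Bruijn levels, and a [code] is turned
   into an expression by the current depth of the environment. *)
Definition code := nat -> expr.
Definition cvar (l : nat) : code := fun d => EVar (d - l.+1).
Definition cnil : code := fun _ => ENil.
Definition cpair (a b : code) : code := fun d => EPair (a d) (b d).
(** In the environment enlarged by two entries the head has index 0, which is level [d.+1], and the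
    tail has index 1, which is level [d]. *)
Definition ccase (e e0 : code) (f : code -> code -> code) : code :=
  fun d => ECase (e d) (e0 d) (f (cvar d.+1) (cvar d) d.+2).
Definition clet (e : code) (f : code -> code) : code :=
  fun d => ELet (e d) (f (cvar d) d.+1).
Definition ccall (f : nat) (e : code) : code := fun d => ECall f (e d).
Definition body (f : code -> code) : expr := f (cvar 0) 1.

Definition cproj (e : code) (f : code -> code -> code) : code := ccase e cnil f.
Definition cif (c a b : code) : code := ccase c b (fun _ _ => a).
Definition cfalse : code := cnil.
Definition ctrue : code := cpair cnil cnil.
Definition cstep (b w : code) : code := cpair ctrue (cpair ctrue (cpair b w)).
Definition ckid (b w : code) : code := cpair ctrue (cpair cfalse (cpair b w)).
Definition clist (s : seq code) : code := foldr cpair cnil s.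

Definition cbin (b nb z x y acc : code) : code :=
  cpair (clist [:: cpair nb z; cpair b x])
  (cpair (clist [:: cpair nb z; cpair b y])
  (cpair (clist [:: cpair b z; cpair nb x; cpair nb y]) acc)).

Definition cmux (s z x y acc : code) : code :=
  cpair (clist [:: cpair ctrue s; cpair ctrue z; cpair cfalse x])
  (cpair (clist [:: cpair ctrue s; cpair cfalse z; cpair ctrue x])
  (cpair (clist [:: cpair cfalse s; cpair ctrue z; cpair cfalse y])
  (cpair (clist [:: cpair cfalse s; cpair cfalse z; cpair ctrue y]) acc))).

Definition f_eq := 1.
Definition f_mem := 2.
Definition f_shared := 3.
Definition f_fresh := 4.
Definition f_falsified := 5.
Definition f_consistent := 6.
Definition f_leaf := 7.
Definition f_ands := 8.
Definition f_trie := 9.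
Definition f_cat := 10.
Definition f_clause_vars := 11.
Definition f_bag := 12.
Definition f_forest := 13.

Definition code_main (i : code) : code :=
  cproj i (fun psi r => cproj r (fun X T =>
  cproj (ccall f_forest (cpair (cpair psi X)
           (cpair cnil (cpair cnil (cpair (cpair T cnil) cnil)))))
    (fun c t => cpair (cpair (clist [:: cpair ctrue cnil]) c) t))).

Definition code_eq (i : code) : code :=
  cproj i (fun x y =>
  ccase x (ccase y ctrue (fun _ _ => cfalse))
    (fun x1 x2 => ccase y cfalse
      (fun y1 y2 => cif (ccall f_eq (cpair x1 y1))
                        (ccall f_eq (cpair x2 y2)) cfalse))).

Definition code_mem (i : code) : code :=
  cproj i (fun x s =>
  ccase s cfalse (fun y s' =>
    cif (ccall f_eq (cpair x y)) ctrue (ccall f_mem (cpair x s')))).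

Definition code_shared (i : code) : code :=
  cproj i (fun B r => cproj r (fun B1 acc =>
  ccase B acc (fun v B' =>
    clet (ccall f_shared (cpair B' (cpair B1 acc)))
      (fun s => cif (ccall f_mem (cpair v B1)) (cpair v s) s)))).

Definition code_fresh (i : code) : code :=
  cproj i (fun B1 B =>
  ccase B1 cnil (fun v B1' =>
    clet (ccall f_fresh (cpair B1' B))
      (fun s => cif (ccall f_mem (cpair v B)) s
                 (cif (ccall f_mem (cpair v s)) s (cpair v s))))).

Definition code_falsified (i : code) : code :=
  cproj i (fun C env =>
  ccase C ctrue (fun l C' =>
    cif (ccall f_mem (cpair l env)) (ccall f_falsified (cpair C' env)) cfalse)).

Definition code_consistent (i : code) : code :=
  cproj i (fun psi env =>
  ccase psi ctrue (fun C psi' =>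
    cif (ccall f_falsified (cpair C env)) cfalse
        (ccall f_consistent (cpair psi' env)))).

Definition code_leaf (i : code) : code :=
  cproj i (fun psi r => cproj r (fun s r => cproj r (fun env r =>
  cproj r (fun w acc =>
  ccase s
    (cpair (clist [:: cpair (ccall f_consistent (cpair psi env)) w]) acc)
    (fun v s' =>
      let branch b acc' :=
        ccall f_leaf (cpair psi (cpair s' (cpair
          (cpair (cpair (if b then cfalse else ctrue) v) env)
          (cpair (cstep (if b then ctrue else cfalse) w) acc')))) in
      branch false (branch true acc)))))).

Definition code_ands (i : code) : code :=
  cproj i (fun B1 r => cproj r (fun s r => cproj r (fun w r =>
  cproj r (fun x r => cproj r (fun y acc =>
  ccase s (cbin ctrue cfalse w x y acc)
    (fun v s' =>
      clet (ccall f_mem (cpair v B1)) (fun m =>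
      let branch b acc' :=
        ccall f_ands (cpair B1 (cpair s' (cpair (cstep b w)
          (cpair (cstep b x) (cpair (cif m (cstep b y) y) acc'))))) in
      branch cfalse (branch ctrue acc)))))))).

Definition code_trie (i : code) : code :=
  cproj i (fun X r => cproj r (fun B r => cproj r (fun s r =>
  cproj r (fun w acc =>
  ccase s acc (fun v s' =>
    clet (cstep cfalse w) (fun w0 => clet (cstep ctrue w) (fun w1 =>
    let branch w' acc' :=
      ccall f_trie (cpair X (cpair B (cpair s' (cpair w' acc')))) in
    clet (branch w0 (branch w1 acc)) (fun K =>
    cif (ccall f_mem (cpair v X))
      (cif (ccall f_mem (cpair v B))
        (cbin cfalse ctrue w w0 w1 K)
        (cmux (cpair cfalse v) w w0 w1 K))
      (cbin cfalse ctrue w w0 w1 K))))))))).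

Definition code_cat (i : code) : code :=
  cproj i (fun s t => ccase s t (fun x s' =>
    cpair x (ccall f_cat (cpair s' t)))).

Definition code_clause_vars (i : code) : code :=
  cproj i (fun C acc => ccase C acc (fun l C' => cproj l (fun _ v =>
    cpair v (ccall f_clause_vars (cpair C' acc))))).

Definition code_bag (i : code) : code :=
  ccase i cnil (fun C K =>
    ccall f_clause_vars (cpair C (ccall f_bag K))).

(** The clauses [K] of a node are generated apart from the accumulator because its bag is read off
    from [K] alone. Only [K] is copied afterwards: the clauses of the siblings serve as accumulator
    for those of the child, so no clause is copied once per level. *)
Definition code_forest (i : code) : code :=
  cproj i (fun ctx r => cproj ctx (fun psi X => cproj r (fun w r =>
  cproj r (fun B r => cproj r (fun F acc =>
  ccase F
    (clet (ccall f_leaf (cpair psi (cpair B (cpair cnil (cpair w cnil)))))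
      (fun K => cpair (ccall f_cat (cpair K acc))
                      (cpair (ccall f_bag K) cnil)))
    (fun t F' => cproj t (fun B1 ts =>
      clet (ckid cfalse w) (fun w0 => clet (ckid ctrue w) (fun w1 =>
      clet (ccall f_shared (cpair B (cpair B1
              (ccall f_fresh (cpair B1 B))))) (fun B1' =>
      clet (ccall f_ands (cpair B1 (cpair B (cpair w (cpair w1 (cpair w0
              (ccall f_trie (cpair X (cpair B (cpair B1'
                 (cpair w0 cnil)))))))))))
        (fun K =>
      cproj (ccall f_forest
               (cpair ctx (cpair w1 (cpair B (cpair F' acc)))))
        (fun c1 t1 =>
      cproj (ccall f_forest
               (cpair ctx (cpair w0 (cpair B1' (cpair ts c1)))))
        (fun c0 t0 =>
      cpair (ccall f_cat (cpair K c0))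
            (cpair (ccall f_bag K) (cpair t0 (cpair t1 cnil)))))))))))))))).

Definition prog : program := Eval vm_compute in
  map body [:: code_main; code_eq; code_mem; code_shared; code_fresh;
    code_falsified; code_consistent; code_leaf; code_ands; code_trie;
    code_cat; code_clause_vars; code_bag; code_forest].

(** * Evaluation within a given number of steps *)

Definition ev (env : seq data) (e : expr) (v : data) (t : nat) : Prop :=
  exists2 s, eval prog env e v s & s <= t.

Definition runs (f : nat) (x v : data) (t : nat) : Prop :=
  ev [:: x] (nth ENil prog f) v t.

Lemma ev_le env e v t t' : ev env e v t -> t <= t' -> ev env e v t'.
Proof. by case=> s H le_st le_tt'; exists s => //; apply: leq_trans le_tt'. Qed.

Lemma ev_var env i v : nth Nil env i = v -> ev env (EVar i) v 1.
Proof. by move<-; exists 1 => //; constructor. Qed.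

Lemma ev_nil env : ev env ENil Nil 1.
Proof. by exists 1 => //; constructor. Qed.

Lemma ev_pair env e1 e2 v1 v2 t1 t2 :
  ev env e1 v1 t1 -> ev env e2 v2 t2 ->
  ev env (EPair e1 e2) (Pair v1 v2) (t1 + t2).+1.
Proof.
move=> [s1 H1 le1] [s2 H2 le2]; exists (s1 + s2).+1; first by constructor.
by rewrite ltnS leq_add.
Qed.

Lemma ev_case_nil env e e0 e1 v t t' :
  ev env e Nil t -> ev env e0 v t' -> ev env (ECase e e0 e1) v (t + t').+1.
Proof.
move=> [s1 H1 le1] [s2 H2 le2]; exists (s1 + s2).+1; first exact: eval_case_nil.
by rewrite ltnS leq_add.
Qed.

Lemma ev_case_pair env e e0 e1 x y v t t' :
  ev env e (Pair x y) t -> ev (x :: y :: env) e1 v t' ->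
  ev env (ECase e e0 e1) v (t + t').+1.
Proof.
move=> [s1 H1 le1] [s2 H2 le2]; exists (s1 + s2).+1.
  exact: eval_case_pair H1 H2.
by rewrite ltnS leq_add.
Qed.

(** Both branches are charged, so that the bound does not depend on the outcome of the test. Truth
    is encoded as [Pair Nil Nil], whence the two entries [Nil] in the environment of [e1]. *)
Lemma ev_if env e e0 e1 b v t t1 t0 :
  ev env e (enc_bool b) t ->
  (b -> ev [:: Nil, Nil & env] e1 v t1) -> (~~ b -> ev env e0 v t0) ->
  ev env (ECase e e0 e1) v (t + (t1 + t0)).+1.
Proof.
case: b => He H1 H0.
  by apply: (ev_le (ev_case_pair _ He (H1 isT))); lia.
by apply: (ev_le (ev_case_nil _ He (H0 isT))); lia.
Qed.

Lemma ev_let env e e' u v t t' :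
  ev env e u t -> ev (u :: env) e' v t' -> ev env (ELet e e') v (t + t').+1.
Proof.
move=> [s1 H1 le1] [s2 H2 le2]; exists (s1 + s2).+1; first exact: eval_let H1 H2.
by rewrite ltnS leq_add.
Qed.

Lemma ev_call env f e u v t t' :
  ev env e u t -> runs f u v t' -> ev env (ECall f e) v (t + t').+1.
Proof.
move=> [s1 H1 le1] [s2 H2 le2]; exists (s1 + s2).+1; first exact: eval_call H1 H2.
by rewrite ltnS leq_add.
Qed.

Ltac ev_step :=
  lazymatch goal with
  | |- ev _ (EVar _) _ _ => apply: ev_var; cbn [nth]; reflexivity
  | |- ev _ ENil _ _ => exact: ev_nil
  | |- ev _ (EPair _ _) _ _ => eapply ev_pair
  | |- ev _ (ELet _ _) _ _ => eapply ev_let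
  | |- ev _ (ECase (EVar _) _ _) _ _ =>
      first [ eapply ev_case_pair; [apply: ev_var; reflexivity|]
            | eapply ev_case_nil; [apply: ev_var; reflexivity|] ]
  | |- ev _ (ECall _ _) _ _ => eapply ev_call
  end.
(** The number of steps is left open and filled in by the derivation; comparing it with the stated
    bound is the last goal. *)
Ltac ev_start := rewrite /runs; eapply ev_le; [rewrite /=|].

Fixpoint deq (x y : data) : bool :=
  match x, y with
  | Nil, Nil => true
  | Pair x1 x2, Pair y1 y2 => deq x1 y1 && deq x2 y2
  | _, _ => false
  end.

Lemma deqP x y : reflect (x = y) (deq x y).
Proof.
apply: (iffP idP) => [|<-].
  by elim: x y => [|x1 IH1 x2 IH2] [|y1 y2] //= /andP[/IH1-> /IH2->].
by elim: x => //= x1 -> x2 ->.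
Qed.

(** The comparison never descends beyond [y]. With a bound in [y] only, a membership test costs
    linear time in the list, whatever the length of the word sought. *)
Lemma runs_eq x y : runs f_eq (Pair x y) (enc_bool (deq x y)) (20 * dsize y).
Proof.
elim: x y => [|x1 IH1 x2 IH2] [|y1 y2].
- by ev_start; [repeat ev_step|].
- by ev_start; [repeat ev_step|rewrite /=; lia].
- by ev_start; [repeat ev_step|].
ev_start; [do 3 ev_step; eapply ev_if|].
- by eapply ev_call; [repeat ev_step|exact: IH1].
- by move=> /= ->; eapply ev_call; [repeat ev_step|exact: IH2].
- by move=> /= /negbTE->; repeat ev_step.
- by rewrite /=; lia.
Qed.

Lemma dsize_gt0 x : 0 < dsize x. Proof. by case: x. Qed.

Lemma runs_mem (A : eqType) (enc : A -> data) (x : A) (s : seq A) :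
  injective enc ->
  runs f_mem (Pair (enc x) (enc_seq enc s)) (enc_bool (x \in s))
    (40 * dsize (enc_seq enc s)).
Proof.
move=> enc_inj; elim: s => [|y s IHs].
  by ev_start; [repeat ev_step|].
ev_start; [do 2 ev_step; eapply ev_if|].
- by eapply ev_call; [repeat ev_step|exact: runs_eq].
- by rewrite in_cons; move=> /deqP/enc_inj->; rewrite eqxx; repeat ev_step.
- rewrite in_cons; case: eqP => [->|_]; first by case: deqP.
  by move=> _; eapply ev_call; [repeat ev_step|exact: IHs].
- by rewrite /=; have := dsize_gt0 (enc y); lia.
Qed.

Lemma enc_bool_inj : injective enc_bool. Proof. by case; case. Qed.

Lemma enc_seq_inj (A : Type) (enc : A -> data) :
  injective enc -> injective (enc_seq enc).
Proof.
by move=> enc_inj; elim=> [|x s IHs] [|y t] //= [/enc_inj-> /IHs->].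
Qed.

Lemma enc_var_inj : injective enc_var.
Proof. exact: enc_seq_inj enc_bool_inj. Qed.

Lemma enc_literal_inj : injective enc_literal.
Proof. by move=> [b x] [c y] [/enc_bool_inj-> /enc_var_inj->]. Qed.

Definition shared (B B1 : seq var) : seq var := [seq v <- B | v \in B1].
Definition fresh (B B1 : seq var) : seq var := undup [seq v <- B1 | v \notin B].

Lemma runs_shared B B1 s :
  runs f_shared (Pair (enc_seq enc_var B)
     (Pair (enc_seq enc_var B1) (enc_seq enc_var s)))
    (enc_seq enc_var (shared B B1 ++ s))
    ((size B).+1 * (40 * dsize (enc_seq enc_var B1) + 40)).
Proof.
elim: B => [|v B IHB].
  by ev_start; [repeat ev_step|rewrite /=; lia].
ev_start; [do 4 ev_step|].
- by eapply ev_call; [repeat ev_step|exact: IHB].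
- eapply ev_if.
  + by eapply ev_call; [repeat ev_step|exact: (runs_mem _ _ enc_var_inj)].
  + by move=> vB1; rewrite /= vB1; repeat ev_step.
  + by move=> /negbTE vB1; rewrite /= vB1; repeat ev_step.
- by rewrite /=; lia.
Qed.

Lemma dsize_enc_seq (A : Type) (enc : A -> data) s :
  dsize (enc_seq enc s) = (\sum_(x <- s) (dsize (enc x)).+1).+1.
Proof. by elim: s => [|x s IHs]; rewrite ?big_nil ?big_cons //= IHs; lia. Qed.

(** Each entry of [s] is charged once and occurs in [t] at least once. This keeps the rearranged
    bags within the size of the original ones. *)
Lemma dsize_uniq_sub (A : eqType) (enc : A -> data) s t :
  uniq s -> {subset s <= t} -> dsize (enc_seq enc s) <= dsize (enc_seq enc t).
Proof.
move=> us st; rewrite !dsize_enc_seq ltnS.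
apply: (sub_le_big_seq leqnn (fun x y => leq_addr y x)) => x; rewrite count_uniq_mem //.
by case: (boolP (x \in s)) => // /st; rewrite -has_pred1 has_count.
Qed.

Lemma runs_fresh n B B1 :
  dsize (enc_seq enc_var B) <= n -> dsize (enc_seq enc_var B1) <= n ->
  runs f_fresh (Pair (enc_seq enc_var B1) (enc_seq enc_var B))
    (enc_seq enc_var (fresh B B1)) ((size B1).+1 * (80 * n + 60)).
Proof.
move=> leB; elim: B1 => [|v B1 IHB] leB1.
  by ev_start; [repeat ev_step|rewrite /=; lia].
have {}leB1 : dsize (enc_seq enc_var B1) <= n by move: leB1 => /=; lia.
have lef : dsize (enc_seq enc_var (fresh B B1)) <= n.
  apply: leq_trans leB1; apply: dsize_uniq_sub; first exact: undup_uniq.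
  by move=> x; rewrite mem_undup mem_filter => /andP[].
ev_start; [do 3 ev_step|].
- by eapply ev_call; [repeat ev_step|exact: IHB].
- eapply ev_if.
  + by eapply ev_call; [repeat ev_step|exact: (runs_mem _ _ enc_var_inj)].
  + by rewrite /fresh /= => ->; repeat ev_step.
  + move=> vB; eapply ev_if.
    * by eapply ev_call; [repeat ev_step|exact: (runs_mem _ _ enc_var_inj)].
    * by rewrite /fresh /= vB /= mem_undup => ->; repeat ev_step.
    * by rewrite /fresh /= vB /= mem_undup => /negbTE->; repeat ev_step.
- by rewrite /=; lia.
Qed.

(* Variables of the output.  An input x of the circuit is named 0x.  A gate is
   named by a word over three-letter blocks, read from the right: 10b goes to the
   child b of a node of the tree, 11b gives the value b to the next variable of
   its bag. *)
Definition step (b : bool) (w : var) : var := [:: true, true, b & w].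
Definition kid (b : bool) (w : var) : var := [:: true, false, b & w].
Definition inp (x : var) : var := false :: x.

(** [Bin true] is a conjunction and [Bin false] a disjunction; by duality their clauses differ only
    in the signs. [Mux s z x y] selects [y] if [s] is true and [x] otherwise. *)
Inductive gate : Type :=
  | Const of bool & var
  | Bin of bool & var & var & var
  | Mux of var & var & var & var.

Definition gate_cnf (g : gate) : cnf :=
  match g with
  | Const b z => [:: [:: (b, z)]]
  | Bin b z x y => [:: [:: (~~ b, z); (b, x)]; [:: (~~ b, z); (b, y)];
                       [:: (b, z); (~~ b, x); (~~ b, y)]]
  | Mux s z x y =>
      [:: [:: (true, s); (true, z); (false, x)];
          [:: (true, s); (false, z); (true, x)];
          [:: (false, s); (true, z); (false, y)];
          [:: (false, s); (false, z); (true, y)]]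
  end.

Definition circuit_cnf (G : seq gate) : cnf := flatten (map gate_cnf G).

(* [env] lists the literals falsified by a partial assignment; a clause with an
   unassigned variable counts as not violated. *)
Definition consistent (psi : cnf) (env : seq literal) : bool :=
  all (fun C : clause => ~~ all [in env] C) psi.

Fixpoint leaf_gates psi s env w : seq gate :=
  if s is v :: s' then
    leaf_gates psi s' ((true, v) :: env) (step false w) ++
    leaf_gates psi s' ((false, v) :: env) (step true w)
  else [:: Const (consistent psi env) w].

(** The words [w], [x], [y] lead to the gates of the node, to those of the remaining siblings under
    the same bag, and into the trie of the child with bag [B1]. The last is indexed by the common
    variables only, hence stands still at the others. *)
Fixpoint and_gates (B1 s : seq var) w x y : seq gate :=
  if s is v :: s' then
    let branch b := and_gates B1 s' (step b w) (step b x)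
                      (if v \in B1 then step b y else y) in
    branch false ++ branch true
  else [:: Bin true w x y].

(* The gates above the variables shared with B are never read; they only make the
   recursion uniform. *)
Fixpoint trie_gates (X B s : seq var) w : seq gate :=
  if s is v :: s' then
    (if (v \in X) && (v \notin B) then Mux (inp v) w (step false w) (step true w)
     else Bin false w (step false w) (step true w)) ::
    trie_gates X B s' (step false w) ++ trie_gates X B s' (step true w)
  else [::].

(** * Running times of the gate generators *)

Lemma runs_falsified C env :
  runs f_falsified (Pair (enc_seq enc_literal C) (enc_seq enc_literal env))
    (enc_bool (all [in env] C))
    ((size C).+1 * (40 * dsize (enc_seq enc_literal env) + 20)).
Proof.
elim: C => [|l C IHC].
  by ev_start; [repeat ev_step|rewrite /=; lia].
ev_start; [do 2 ev_step; eapply ev_if|].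
- by eapply ev_call; [repeat ev_step|exact: (runs_mem _ _ enc_literal_inj)].
- by rewrite /= => ->; eapply ev_call; [repeat ev_step|exact: IHC].
- by rewrite /= => /negbTE->; repeat ev_step.
- by rewrite /=; set m := dsize _; lia.
Qed.

Lemma size_lt_dsize (A : Type) (enc : A -> data) s :
  size s < dsize (enc_seq enc s).
Proof. by elim: s => //= x s; lia. Qed.

Lemma runs_consistent psi env :
  runs f_consistent (Pair (enc_cnf psi) (enc_seq enc_literal env))
    (enc_bool (consistent psi env))
    (dsize (enc_cnf psi) * (40 * dsize (enc_seq enc_literal env) + 60)).
Proof.
elim: psi => [|C psi IHpsi].
  by ev_start; [repeat ev_step|rewrite /=; lia].
ev_start; [do 2 ev_step; eapply ev_if|].
- by eapply ev_call; [repeat ev_step|exact: runs_falsified].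
- by rewrite /= => ->; repeat ev_step.
- by rewrite /= => ->; eapply ev_call; [repeat ev_step|exact: IHpsi].
- rewrite /= -/(enc_cnf psi); have := size_lt_dsize enc_literal C.
  set m := dsize (enc_seq enc_literal env).
  set c := dsize (enc_seq _ C); set q := dsize (enc_cnf _) => ltC.
  by have := leq_mul ltC (leqnn (40 * m + 20)); lia.
Qed.

Lemma circuit_cnf_cat G1 G2 :
  circuit_cnf (G1 ++ G2) = circuit_cnf G1 ++ circuit_cnf G2.
Proof. by rewrite /circuit_cnf map_cat flatten_cat. Qed.

(** The recurrence of a generator that calls itself twice: [(2 ^ m.+1).-1] is the number of nodes of
    a full binary tree of depth [m], and [D] is the charge per node. *)
Lemma double_bound a m D : a <= D ->
  (2 ^ m.+1).-1 * D + (2 ^ m.+1).-1 * D + a <= (2 ^ m.+2).-1 * D.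
Proof.
move=> leaD; rewrite (expnS 2 m.+1); have := expn_gt0 2 m.+1.
by set p := 2 ^ m.+1 => /= p_gt0; nia.
Qed.

(** [E] bounds the environment at the end of the recursion. Each variable adds to it a literal of
    size at most [n + 5]: two for the pairs, three for the sign and [n] for the name. *)
Lemma runs_leaf n E D psi s env w acc :
  {in s, forall v, dsize (enc_var v) <= n} ->
  dsize (enc_seq enc_literal env) + size s * (n + 5) <= E ->
  dsize (enc_cnf psi) * (40 * E + 60) + 200 <= D ->
  runs f_leaf (Pair (enc_cnf psi) (Pair (enc_seq enc_var s)
     (Pair (enc_seq enc_literal env) (Pair (enc_var w) (enc_cnf acc)))))
    (enc_cnf (circuit_cnf (leaf_gates psi s env w) ++ acc))
    ((2 ^ (size s).+1).-1 * D).
Proof.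
elim: s env w acc => [|v s IHs] env w acc len leE leD.
  ev_start; [repeat ev_step; exact: runs_consistent|rewrite /=].
  by move: leE leD; set m := dsize _; set q := dsize _; nia.
have {}len : {in s, forall v, dsize (enc_var v) <= n} /\ dsize (enc_var v) <= n.
  by split=> [u us|]; apply: len; rewrite inE ?us ?orbT ?eqxx.
case: len => len lev.
ev_start; [do 5 ev_step; eapply ev_call; [repeat ev_step|]|].
- by apply: (IHs ((false, v) :: env) (step true w) acc) => //=; move: leE => /=; lia.
- rewrite /= circuit_cnf_cat -catA.
  by apply: (IHs ((true, v) :: env) (step false w)) => //=; move: leE => /=; lia.
- have D200 : 200 <= D by lia.
  apply: (leq_trans _ (double_bound (size s) D200)) => /=.
  set p := _.-1 * D. lia.
Qed.

Lemma runs_ands D B1 s w x y acc :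
  40 * dsize (enc_seq enc_var B1) + 300 <= D ->
  runs f_ands (Pair (enc_seq enc_var B1) (Pair (enc_seq enc_var s)
     (Pair (enc_var w) (Pair (enc_var x) (Pair (enc_var y) (enc_cnf acc))))))
    (enc_cnf (circuit_cnf (and_gates B1 s w x y) ++ acc))
    ((2 ^ (size s).+1).-1 * D).
Proof.
move=> leD; elim: s w x y acc => [|v s IHs] w x y acc.
  by ev_start; [repeat ev_step|rewrite /=; lia].
ev_start; [do 6 ev_step; eapply ev_let|].
- by eapply ev_call; [repeat ev_step|exact: (runs_mem _ _ enc_var_inj)].
- repeat ev_step.
  + by eapply (ev_if (v := enc_var (if v \in B1 then step false y else y)));
      [ev_step|move=> ->; repeat ev_step|move=> /negbTE->; repeat ev_step].
  + by eapply (ev_if (v := enc_var (if v \in B1 then step true y else y)));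
      [ev_step|move=> ->; repeat ev_step|move=> /negbTE->; repeat ev_step].
  + exact: (IHs (step true w) (step true x)).
  + rewrite /= circuit_cnf_cat -catA.
    exact: (IHs (step false w) (step false x)).
- apply: (leq_trans _ (double_bound (size s) leD)) => /=.
  by set p := _.-1 * D; set m := dsize _; lia.
Qed.

Lemma runs_trie D X B s w acc :
  40 * dsize (enc_seq enc_var X) + 40 * dsize (enc_seq enc_var B) + 300 <= D ->
  runs f_trie (Pair (enc_seq enc_var X) (Pair (enc_seq enc_var B)
     (Pair (enc_seq enc_var s) (Pair (enc_var w) (enc_cnf acc)))))
    (enc_cnf (circuit_cnf (trie_gates X B s w) ++ acc))
    ((2 ^ (size s).+1).-1 * D).
Proof.
move=> leD; elim: s w acc => [|v s IHs] w acc.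
  by ev_start; [repeat ev_step|rewrite /=; lia].
ev_start; [repeat ev_step|].
- exact: (IHs (step true w)).
- exact: (IHs (step false w)).
- rewrite /circuit_cnf /= map_cat flatten_cat -!catA.
  set K := flatten _ ++ _; eapply ev_if.
  + by eapply ev_call; [repeat ev_step|exact: (runs_mem _ _ enc_var_inj)].
  + move=> -> /=; eapply ev_if.
    * by eapply ev_call; [repeat ev_step|exact: (runs_mem _ _ enc_var_inj)].
    * by move=> -> /=; repeat ev_step.
    * by move=> -> /=; repeat ev_step.
  + by move=> /negbTE-> /=; repeat ev_step.
- apply: (leq_trans _ (double_bound (size s) leD)) => /=.
  by set p := _.-1 * D; set m := dsize _; set q := dsize _; lia.
Qed.

Lemma runs_cat K acc :
  runs f_cat (Pair (enc_cnf K) (enc_cnf acc)) (enc_cnf (K ++ acc))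
    (20 * (size K).+1).
Proof.
elim: K => [|C K IHK]; first by ev_start; [repeat ev_step|].
by ev_start; [repeat ev_step; exact: IHK|rewrite /=; lia].
Qed.

Lemma runs_clause_vars C s :
  runs f_clause_vars (Pair (enc_seq enc_literal C) (enc_seq enc_var s))
    (enc_seq enc_var (clause_vars C ++ s)) (20 * (size C).+1).
Proof.
elim: C => [|l C IHC]; first by ev_start; [repeat ev_step|].
by ev_start; [repeat ev_step; exact: IHC|rewrite /=; lia].
Qed.

Definition bag_of (K : cnf) : seq var := flatten (map clause_vars K).

Lemma runs_bag K :
  runs f_bag (enc_cnf K) (enc_seq enc_var (bag_of K))
    (40 * (size (flatten K) + size K).+1).
Proof.
elim: K => [|C K IHK]; first by ev_start; [repeat ev_step|].
ev_start; [repeat ev_step; [exact: IHK|exact: runs_clause_vars]|].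
by rewrite /= size_cat; lia.
Qed.

(* The left-child right-sibling form of a list of bag trees, on which the
   recursion is structural.  Both have the same encoding as data, so the program
   does not convert between them. *)
Inductive btree : Type := Leaf | Node of seq var & btree & btree.

Fixpoint enc_btree (F : btree) : data :=
  if F is Node B l r then
    Pair (Pair (enc_seq enc_var B) (enc_btree l)) (enc_btree r)
  else Nil.

Fixpoint btree_size (F : btree) : nat :=
  if F is Node B l r then (btree_size l + btree_size r).+1 else 1.

Fixpoint btree_bags (F : btree) : seq (seq var) :=
  if F is Node B l r then B :: btree_bags l ++ btree_bags r else [::].

(* The variables shared with the parent come first, so the gate of the parent's
   assignment restricted to them is the node of the child's trie at a prefix. *)
Definition next_bag (B B1 : seq var) : seq var := shared B B1 ++ fresh B B1.

(** The chain of siblings below a bag keeps that bag and ends in exactly one [Leaf], so the clauses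
    inside each bag are tested once, there. The leaves of the trie are not generated here: by their
    names they are the gates of the child itself. *)
Definition local_gates psi X F B w : seq gate :=
  if F is Node B1 l r then
    and_gates B1 B w (kid true w) (kid false w) ++
    trie_gates X B (next_bag B B1) (kid false w)
  else leaf_gates psi B [::] w.

Fixpoint forest_gates psi X F B w : seq gate :=
  local_gates psi X F B w ++
  if F is Node B1 l r then
    forest_gates psi X l (next_bag B B1) (kid false w) ++
    forest_gates psi X r B (kid true w)
  else [::].

Fixpoint forest_tree psi X F B w : bag_tree :=
  BagNode (bag_of (circuit_cnf (local_gates psi X F B w)))
    (if F is Node B1 l r then
       [:: forest_tree psi X l (next_bag B B1) (kid false w);
           forest_tree psi X r B (kid true w)]
     else [::]).

Lemma mem_next_bag B B1 : next_bag B B1 =i B1.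
Proof.
move=> v; rewrite mem_cat mem_undup !mem_filter.
by case: (v \in B) => /=; rewrite ?andbT ?andbF ?orbF.
Qed.

Lemma uniq_next_bag B B1 : uniq B -> uniq (next_bag B B1).
Proof.
move=> uB; rewrite cat_uniq filter_uniq // undup_uniq andbT /=.
apply/hasPn => v; rewrite mem_undup !mem_filter => /andP[/negbTE-> _].
by rewrite andbF.
Qed.

Lemma size_next_bag B B1 :
  uniq B -> size (next_bag B B1) = size (undup B1).
Proof.
move=> uB; apply: perm_size; apply: uniq_perm => [||v]; first exact: uniq_next_bag.
  exact: undup_uniq.
by rewrite mem_undup mem_next_bag.
Qed.

Lemma dsize_next_bag B B1 :
  uniq B -> dsize (enc_seq enc_var (next_bag B B1)) <= dsize (enc_seq enc_var B1).
Proof.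
move=> uB; apply: dsize_uniq_sub; first exact: uniq_next_bag.
by move=> v; rewrite mem_next_bag.
Qed.

Lemma size_leaf_gates psi s env w : size (leaf_gates psi s env w) = 2 ^ size s.
Proof. by elim: s env w => //= v s IHs env w; rewrite size_cat !IHs expnS; lia. Qed.

Lemma size_and_gates B1 s w x y : size (and_gates B1 s w x y) = 2 ^ size s.
Proof. by elim: s w x y => //= v s IHs w x y; rewrite size_cat !IHs expnS; lia. Qed.

Lemma size_trie_gates X B s w : size (trie_gates X B s w) = (2 ^ size s).-1.
Proof.
elim: s w => //= v s IHs w; rewrite size_cat !IHs expnS.
by have := expn_gt0 2 (size s); lia.
Qed.

(** The worst case, here and for the number of literals, is [Mux] with four clauses of three
    literals. *)
Lemma size_circuit_cnf G : size (circuit_cnf G) <= 4 * size G.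
Proof.
elim: G => //= g G; rewrite /circuit_cnf /= size_cat -/(circuit_cnf G).
by case: g => * /=; lia.
Qed.

Lemma size_flatten_circuit_cnf G : size (flatten (circuit_cnf G)) <= 12 * size G.
Proof.
elim: G => //= g G; rewrite /circuit_cnf /= flatten_cat size_cat -/(circuit_cnf G).
by case: g => * /=; lia.
Qed.

Definition bounded n m B := dsize (enc_seq enc_var B) <= n /\ size (undup B) <= m.

Lemma bounded_next n m B B1 : uniq B -> bounded n m B1 -> bounded n m (next_bag B B1).
Proof.
move=> uB [len lem]; split; first exact: leq_trans (dsize_next_bag _ uB) len.
by rewrite undup_id ?uniq_next_bag // size_next_bag.
Qed.

Lemma size_local_gates psi X F B w m :
  uniq B -> size B <= m ->
  {in btree_bags F, forall B1, size (undup B1) <= m} ->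
  size (local_gates psi X F B w) <= 2 * 2 ^ m.
Proof.
move=> uB leB; case: F => [|B1 l r] /= leF.
  rewrite size_leaf_gates (leq_trans (leq_pexp2l (ltn0Sn 1) leB)) //.
  by rewrite leq_pmull.
rewrite size_cat size_and_gates size_trie_gates size_next_bag //.
have leB1 : size (undup B1) <= m by apply: leF; rewrite mem_head.
rewrite mul2n -addnn leq_add ?leq_pexp2l //.
by rewrite (leq_trans (leq_pred _)) ?leq_pexp2l.
Qed.

Lemma dsize_mem (B : seq var) v :
  v \in B -> dsize (enc_var v) <= dsize (enc_seq enc_var B).
Proof.
by elim: B => //= u B IHB; rewrite inE => /orP[/eqP->|/IHB]; lia.
Qed.

Lemma runs_local_leaf n m psi B w :
  dsize (enc_cnf psi) <= n -> uniq B -> bounded n m B ->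
  runs f_leaf (Pair (enc_cnf psi) (Pair (enc_seq enc_var B)
     (Pair Nil (Pair (enc_var w) Nil))))
    (enc_cnf (circuit_cnf (leaf_gates psi B [::] w))) (2000 * (2 ^ m * n ^ 3)).
Proof.
move=> len uB [leBn]; rewrite undup_id // => leBm.
(* Fewer than [n] variables add [n + 5] each to an empty environment, which stays below [7 * n ^ 2];
   then [n * (40 * (7 * n ^ 2) + 60) + 200] is at most [1000 * n ^ 3]. *)
have := @runs_leaf n (7 * n ^ 2) (1000 * n ^ 3) psi B [::] w [::].
rewrite cats0 => H; eapply ev_le; first apply: H.
- by move=> v /dsize_mem /leq_trans; apply.
- have := size_lt_dsize enc_var B; rewrite /= => lt; nia.
- by have := dsize_gt0 (enc_cnf psi); nia.
have := leq_pexp2l (ltn0Sn 1) leBm; rewrite expnS.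
set p := 2 ^ _; set q := 2 ^ m => lepq.
apply: (@leq_trans (2 * q * (1000 * n ^ 3))); last by lia.
by rewrite leq_mul2r; apply/orP; right; lia.
Qed.

Lemma leq_pow_cube m n a c b :
  0 < n -> a <= m -> b <= c * n ^ 3 -> (2 ^ a.+1).-1 * b <= 2 * c * (2 ^ m * n ^ 3).
Proof.
move=> n_gt0 leam leb; have := leq_pexp2l (ltn0Sn 1) leam; rewrite expnS.
set p := 2 ^ a; set q := 2 ^ m => lepq.
apply: (@leq_trans (2 * q * (c * n ^ 3))); last by lia.
by apply: leq_mul => //; lia.
Qed.

Lemma leq_mul_cube n a b c : 0 < n -> a <= n -> b <= c * n -> a * b <= c * n ^ 3.
Proof.
move=> n_gt0 lean leb; apply: (leq_trans (leq_mul lean leb)).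
by rewrite mulnCA leq_mul2l mulnn leq_pexp2l ?orbT.
Qed.

Lemma runs_local_node n m psi X B B1 l r w :
  0 < n -> dsize (enc_seq enc_var X) <= n ->
  uniq B -> bounded n m B -> bounded n m B1 ->
  exists t1 t2, t1 + t2 <= 2000 * (2 ^ m * n ^ 3) /\
  exists K1,
  [/\ runs f_trie (Pair (enc_seq enc_var X) (Pair (enc_seq enc_var B)
         (Pair (enc_seq enc_var (next_bag B B1))
         (Pair (enc_var (kid false w)) Nil)))) K1 t1
    & runs f_ands (Pair (enc_seq enc_var B1) (Pair (enc_seq enc_var B)
         (Pair (enc_var w) (Pair (enc_var (kid true w))
         (Pair (enc_var (kid false w)) K1)))))
      (enc_cnf (circuit_cnf (local_gates psi X (Node B1 l r) B w))) t2].
Proof.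
move=> n_gt0 leX uB bB bB1.
have [leBn leBm] := bB; have [leB1n leB1m] := bB1.
move: leBm; rewrite undup_id // => leBm.
have [leNn] := bounded_next uB bB1; rewrite undup_id ?uniq_next_bag // => leNm.
pose K := circuit_cnf (trie_gates X B (next_bag B B1) (kid false w)).
exists ((2 ^ (size (next_bag B B1)).+1).-1 * (400 * n ^ 3)).
exists ((2 ^ (size B).+1).-1 * (400 * n ^ 3)).
split.
  apply: leq_trans (leq_add (@leq_pow_cube m n _ 400 _ n_gt0 leNm (leqnn _))
                            (@leq_pow_cube m n _ 400 _ n_gt0 leBm (leqnn _))) _.
  by lia.
exists (enc_cnf K); split.
  by have := @runs_trie (400 * n ^ 3) X B (next_bag B B1) (kid false w) [::];
    rewrite cats0; apply; nia.
rewrite /local_gates circuit_cnf_cat; apply: runs_ands; nia.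
Qed.

Lemma runs_cat_bag n m G acc :
  0 < n -> size G <= 2 * 2 ^ m ->
  exists t1 t2, t1 + t2 <= 2000 * (2 ^ m * n ^ 3) /\
  (runs f_cat (Pair (enc_cnf (circuit_cnf G)) (enc_cnf acc))
     (enc_cnf (circuit_cnf G ++ acc)) t1 /\
   runs f_bag (enc_cnf (circuit_cnf G))
     (enc_seq enc_var (bag_of (circuit_cnf G))) t2).
Proof.
move=> n_gt0 leG; do 2 eexists; split; last by split; [exact: runs_cat|exact: runs_bag].
have := size_circuit_cnf G; have := size_flatten_circuit_cnf G.
have n3 : 0 < n ^ 3 by rewrite expn_gt0 n_gt0.
have : 0 < 2 ^ m by rewrite expn_gt0.
set a := size _; set b := size (circuit_cnf G); move: leG; set q := 2 ^ m.
move=> leG q_gt0 lea leb; have : q <= q * n ^ 3 by rewrite leq_pmulr.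
by lia.
Qed.

(** In units of [2 ^ m * n ^ 3], a node pays 2000 for generating its gates, 2000 for copying them
    and reading off the bag, 80 and 140 for the common and the fresh variables, and a constant for
    the glue. *)
Lemma runs_forest n m psi X F B w acc :
  0 < n -> dsize (enc_cnf psi) <= n -> dsize (enc_seq enc_var X) <= n ->
  uniq B -> bounded n m B -> {in btree_bags F, forall B1, bounded n m B1} ->
  runs f_forest
    (Pair (Pair (enc_cnf psi) (enc_seq enc_var X)) (Pair (enc_var w)
       (Pair (enc_seq enc_var B) (Pair (enc_btree F) (enc_cnf acc)))))
    (enc_output (circuit_cnf (forest_gates psi X F B w) ++ acc)
                (forest_tree psi X F B w))
    (btree_size F * (5000 * (2 ^ m * n ^ 3))).
Proof.
move=> n_gt0 lepsi leX.
have Q_gt0 : 0 < 2 ^ m * n ^ 3 by rewrite muln_gt0 !expn_gt0 n_gt0.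
elim: F B w acc => [|B1 l IHl r IHr] B w acc uB bB bF.
  have sG : size (leaf_gates psi B [::] w) <= 2 * 2 ^ m.
    have [_] := bB; rewrite undup_id // => leBm.
    exact: (@size_local_gates psi X Leaf B w m).
  have [t1 [t2 [let12 [Hcat Hbag]]]] := runs_cat_bag acc n_gt0 sG.
  ev_start; [repeat ev_step|].
  - exact: runs_local_leaf lepsi uB bB.
  - rewrite /= cats0; exact: Hcat.
  - exact: Hbag.
  - move: let12 Q_gt0; set q := 2 ^ m * n ^ 3 => /=; lia.
have bB1 : bounded n m B1 by apply: bF; rewrite mem_head.
have bl : {in btree_bags l, forall B1, bounded n m B1}.
  by move=> D Dl; apply: bF; rewrite inE mem_cat Dl orbT.
have br : {in btree_bags r, forall B1, bounded n m B1}.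
  by move=> D Dr; apply: bF; rewrite inE mem_cat Dr !orbT.
have [t1 [t2 [let12 [K1 [H1 H2]]]]] :=
  runs_local_node psi l r w n_gt0 leX uB bB bB1.
have sG : size (local_gates psi X (Node B1 l r) B w) <= 2 * 2 ^ m.
  apply: size_local_gates => //; first by have [_] := bB; rewrite undup_id.
  by move=> D /bF[].
have [t3 [t4 [let34 [Hcat Hbag]]]] := runs_cat_bag
  (circuit_cnf (forest_gates psi X l (next_bag B B1) (kid false w)) ++
   circuit_cnf (forest_gates psi X r B (kid true w)) ++ acc) n_gt0 sG.
rewrite /= !circuit_cnf_cat -circuit_cnf_cat -!catA.
move: H2 Hcat Hbag {sG}; rewrite /local_gates; set G := _ ++ _.
move: G => G H2 Hcat Hbag.
ev_start; [repeat ev_step|].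
- exact: runs_fresh (proj1 bB) (proj1 bB1).
- exact: runs_shared.
- exact: H1.
- exact: H2.
- eapply ev_case_pair.
  + by repeat ev_step; exact: (IHr _ (kid true w)).
  + eapply ev_case_pair.
      by repeat ev_step; apply: (IHl _ (kid false w)) => //;
        [exact: uniq_next_bag|exact: bounded_next].
    by repeat ev_step; [exact: Hcat|exact: Hbag].
- rewrite /=.
  have := size_lt_dsize enc_var B; have := size_lt_dsize enc_var B1.
  move: (proj1 bB) (proj1 bB1); set b := dsize _; set b1 := dsize _ => leb leb1 ltb1 ltb.
  have c1 : (size B).+1 * (40 * b1 + 40) <= 80 * n ^ 3.
    by apply: leq_mul_cube; [|exact: leq_trans leb|lia].
  have c2 : (size B1).+1 * (80 * n + 60) <= 140 * n ^ 3.
    by apply: leq_mul_cube; [|exact: leq_trans leb1|lia].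
  have nQ : n ^ 3 <= 2 ^ m * n ^ 3 by rewrite leq_pmull ?expn_gt0.
  move: let12 let34 Q_gt0 c1 c2 nQ; set q := 2 ^ m * n ^ 3; set u := _ * (40 * _ + 40).
  set v := _ * (80 * _ + 60); lia.
Qed.

(** * Circuits *)

(** Valuations are total here, so that passing to a part of a circuit or to a single bag changes no
    domain. Assignments of a fixed list of variables return only in the count. *)
Definition sat (beta : var -> bool) (psi : cnf) : bool :=
  all (has (fun l : literal => beta l.2 == l.1)) psi.

Definition gate_out (g : gate) : var :=
  match g with Const _ z => z | Bin _ z _ _ => z | Mux _ z _ _ => z end.

Definition gate_args (g : gate) : seq var :=
  match g with
  | Const _ _ => [::] | Bin _ _ x y => [:: x; y] | Mux s _ x y => [:: s; x; y]
  end.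

Definition gate_val (beta : var -> bool) (g : gate) : bool :=
  match g with
  | Const b _ => b
  | Bin b _ x y => if b then beta x && beta y else beta x || beta y
  | Mux s _ x y => if beta s then beta y else beta x
  end.

Lemma sat_cat beta psi1 psi2 : sat beta (psi1 ++ psi2) = sat beta psi1 && sat beta psi2.
Proof. exact: all_cat. Qed.

Lemma sat_gate beta g : sat beta (gate_cnf g) = (beta (gate_out g) == gate_val beta g).
Proof.
case: g => [b z|b z x y|s z x y]; rewrite /sat /=.
- by rewrite !orbF andbT.
- by case: b; case: (beta z); case: (beta x); case: (beta y).
- by case: (beta s); case: (beta z); case: (beta x); case: (beta y).
Qed.

Lemma sat_circuit_cons beta g G :
  sat beta (circuit_cnf (g :: G)) =
  (beta (gate_out g) == gate_val beta g) && sat beta (circuit_cnf G).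
Proof. by rewrite /circuit_cnf /= sat_cat sat_gate. Qed.

Lemma sat_circuit_cat beta G1 G2 :
  sat beta (circuit_cnf (G1 ++ G2)) =
  sat beta (circuit_cnf G1) && sat beta (circuit_cnf G2).
Proof. by rewrite circuit_cnf_cat sat_cat. Qed.

Lemma bag_of_cat K1 K2 : bag_of (K1 ++ K2) = bag_of K1 ++ bag_of K2.
Proof. by rewrite /bag_of map_cat flatten_cat. Qed.

Lemma mem_bag_gate g z :
  (z \in bag_of (gate_cnf g)) = (z \in gate_out g :: gate_args g).
Proof.
case: g => [b u|b u x y|s u x y]; rewrite /bag_of /= !inE //.
  by case: eqP; case: eqP; case: eqP.
by case: eqP; case: eqP; case: eqP; case: eqP.
Qed.

Lemma mem_bag_circuit G z :
  (z \in bag_of (circuit_cnf G)) =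
  (z \in map gate_out G) || (z \in flatten (map gate_args G)).
Proof.
elim: G => //= g G IHG.
rewrite /circuit_cnf /= bag_of_cat mem_cat IHG mem_bag_gate !inE mem_cat.
by rewrite -!orbA; congr (_ || _); rewrite orbCA.
Qed.

Lemma eq_gate_val beta1 beta2 g :
  {in gate_args g, beta1 =1 beta2} -> gate_val beta1 g = gate_val beta2 g.
Proof.
by case: g => [b u|b u x y|s u x y] eqb //=; rewrite !eqb ?inE ?eqxx ?orbT.
Qed.

(* Gates are listed from the output down: the arguments of a gate are in S or are
   outputs of later gates. *)
Fixpoint grounded (S : pred var) (G : seq gate) : bool :=
  if G is g :: G' then
    all (fun y => (y \in map gate_out G') || S y) (gate_args g) && grounded S G'
  else true.

Lemma sub_grounded (S1 S2 : pred var) G :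
  subpred S1 S2 -> grounded S1 G -> grounded S2 G.
Proof.
move=> sub; elim: G => //= g G IHG /andP[Hg /IHG->]; rewrite andbT.
by apply: sub_all Hg => y /orP[->//|/sub->]; rewrite orbT.
Qed.

Lemma grounded_cat (S : pred var) G1 G2 :
  grounded (fun y => (y \in map gate_out G2) || S y) G1 -> grounded S G2 ->
  grounded S (G1 ++ G2).
Proof.
move=> + H2; elim: G1 => //= g G IHG /andP[Hg /IHG->]; rewrite andbT.
by apply: sub_all Hg => y; rewrite map_cat mem_cat orbA.
Qed.

Lemma grounded_args (S : pred var) G z :
  grounded S G -> z \in flatten (map gate_args G) ->
  (z \in map gate_out G) || S z.
Proof.
elim: G => //= g G IHG /andP[/allP Hg HG]; rewrite mem_cat inE.
by case/orP => [/Hg|/(IHG HG)] /orP[->|->]; rewrite ?orbT.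
Qed.

(** The tail of the list is settled first; the head gate reads only the tail and [S]. *)
Lemma circuit_unique (S : pred var) beta1 beta2 G :
  grounded S G -> (forall z, S z -> beta1 z = beta2 z) ->
  sat beta1 (circuit_cnf G) -> sat beta2 (circuit_cnf G) ->
  {in map gate_out G, beta1 =1 beta2}.
Proof.
move=> + eqS; elim: G => //= g G IHG /andP[/allP Hg HG].
rewrite !sat_circuit_cons => /andP[/eqP E1 S1] /andP[/eqP E2 S2] z.
rewrite inE => /orP[/eqP->|]; last exact: (IHG HG S1 S2).
rewrite E1 E2; apply: eq_gate_val => y /Hg /orP[|/eqS//].
exact: (IHG HG S1 S2).
Qed.

Lemma circuit_exists (S : pred var) beta0 G :
  grounded S G -> uniq (map gate_out G) ->
  (forall z, z \in map gate_out G -> ~~ S z) ->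
  exists2 beta, (forall z, S z -> beta z = beta0 z) & sat beta (circuit_cnf G).
Proof.
elim: G => [|g G IHG] /=; first by exists beta0.
move=> /andP[/allP Hg HG] /andP[gG uG] noS.
have [|beta eqb satb] := IHG HG uG.
  by move=> z zG; apply: noS; rewrite inE zG orbT.
(* The new output is neither in [S] nor an output of the tail, and these are all the variables of
   the tail; so the override disturbs nothing already evaluated. *)
pose beta' z := if z == gate_out g then gate_val beta g else beta z.
have gNS : ~~ S (gate_out g) by apply: noS; rewrite mem_head.
have eqb' z : (z \in map gate_out G) || S z -> beta' z = beta z.
  rewrite /beta'; case: eqP => // ->.
  by rewrite (negbTE gG) (negbTE gNS).
exists beta'.
  by move=> z zi; rewrite -eqb // eqb' ?zi ?orbT.
rewrite sat_circuit_cons {1}/beta' eqxx.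
rewrite (@eq_gate_val beta' beta) ?eqxx /=; last by move=> y /Hg /eqb'.
move: satb; rewrite /sat => /allP satb; apply/allP => C CG.
have [l lC lb] := hasP (satb C CG); apply/hasP; exists l => //.
rewrite eqb' //; have : l.2 \in bag_of (circuit_cnf G).
  by apply/flattenP; exists (clause_vars C); apply: map_f.
by rewrite mem_bag_circuit => /orP[->//|/(grounded_args HG)].
Qed.

(** * Names of gates: a node address and a partial assignment, latest choice first *)

Definition nm (a p : seq bool) : var := foldr step (foldr kid [::] a) p.

Lemma nm_step b a p : step b (nm a p) = nm a (b :: p). Proof. by []. Qed.
Lemma nm_kid b a : kid b (nm a [::]) = nm (b :: a) [::]. Proof. by []. Qed.

(** The second letter of each block tells a choice of value from a choice of child, so a name can be
    decoded from its front. *)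
Lemma nm_inj a p a' p' : nm a p = nm a' p' -> a = a' /\ p = p'.
Proof.
elim: p p' => [|b p IHp] [|b' p'].
- by move=> E; split=> //; elim: a a' E => [|b a IHa] [|b' a'] //= [-> /IHa->].
- by case: a.
- by case: a' {IHp}.
- by move=> [-> /IHp[-> ->]].
Qed.

Lemma nm_not_inp a p X : nm a p \notin map inp X.
Proof. by apply/mapP => -[x _]; case: p; case: a. Qed.

Arguments nm : simpl never.

Definition path_word (p : seq bool) (w : var) : var := foldl (fun w b => step b w) w p.

Fixpoint paths m w : seq var :=
  if m is m'.+1 then paths m' (step false w) ++ paths m' (step true w) else [:: w].

Fixpoint inner_paths m w : seq var :=
  if m is m'.+1 then
    w :: inner_paths m' (step false w) ++ inner_paths m' (step true w)
  else [::].

Lemma pathsP m a q z :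
  z \in paths m (nm a q) -> exists2 p, size p = m & z = nm a (p ++ q).
Proof.
elim: m q => [|m IHm] q /=; first by rewrite inE => /eqP->; exists [::].
by rewrite mem_cat (nm_step false) (nm_step true) => /orP[] /IHm[p sp ->];
  [exists (rcons p false)|exists (rcons p true)]; rewrite ?size_rcons ?sp ?cat_rcons.
Qed.

Lemma inner_pathsP m a q z :
  z \in inner_paths m (nm a q) -> exists2 p, size p < m & z = nm a (p ++ q).
Proof.
elim: m q => [|m IHm] q //=; rewrite inE mem_cat (nm_step false) (nm_step true).
case/or3P=> [/eqP->|/IHm[p sp ->]|/IHm[p sp ->]]; first by exists [::].
  by exists (rcons p false); rewrite ?size_rcons ?sp ?cat_rcons.
by exists (rcons p true); rewrite ?size_rcons ?sp ?cat_rcons.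
Qed.

(** Comparison from the right end, where the earliest choices are. It separates the names in the two
    branches of a trie and in the two subtrees of a node. *)
Lemma cat_cons_inj (T : eqType) (p p' q q' : seq T) b b' :
  p ++ b :: q = p' ++ b' :: q' -> size q = size q' -> b = b' /\ q = q'.
Proof.
move=> E sq; have sp : size p = size p'.
  by move/(congr1 size): E; rewrite !size_cat /= sq; lia.
by move/eqP: E; rewrite eqseq_cat // => /andP[_ /eqP[-> ->]].
Qed.

Lemma uniq_paths m a q : uniq (paths m (nm a q)).
Proof.
elim: m q => [|m IHm] q //=.
rewrite cat_uniq (nm_step false) (nm_step true) !IHm andbT andTb.
apply/hasPn => z /pathsP[p sp ->]; apply/negP => /pathsP[p' sp' /nm_inj[_ E]].
by case: (cat_cons_inj E).
Qed.

Lemma uniq_inner_paths m a q : uniq (inner_paths m (nm a q)).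
Proof.
elim: m q => [|m IHm] q //=.
rewrite cat_uniq (nm_step false) (nm_step true) !IHm andbT mem_cat.
have noth b : nm a q \notin inner_paths m (nm a (b :: q)).
  apply/negP => /inner_pathsP[p _ /nm_inj[_ /(congr1 size)]].
  by rewrite size_cat /=; lia.
rewrite negb_or !noth !andTb.
apply/hasPn => z /inner_pathsP[p sp ->]; apply/negP => /inner_pathsP[p' sp' /nm_inj[_ E]].
by case: (cat_cons_inj E).
Qed.

Lemma outs_leaf psi s env w : map gate_out (leaf_gates psi s env w) = paths (size s) w.
Proof. by elim: s env w => //= v s IHs env w; rewrite map_cat !IHs. Qed.

Lemma outs_and B1 s w x y : map gate_out (and_gates B1 s w x y) = paths (size s) w.
Proof. by elim: s w x y => //= v s IHs w x y; rewrite map_cat !IHs. Qed.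

Lemma outs_trie X B s w : map gate_out (trie_gates X B s w) = inner_paths (size s) w.
Proof. by elim: s w => //= v s IHs w; rewrite map_cat !IHs; case: ifP. Qed.

Lemma grounded_cat2 (S : pred var) G1 G2 :
  grounded S G1 -> grounded S G2 -> grounded S (G1 ++ G2).
Proof.
move=> H1; apply: grounded_cat; apply: sub_grounded H1 => y Sy.
by rewrite Sy orbT.
Qed.

Lemma grounded_leaf S psi s env w : grounded S (leaf_gates psi s env w).
Proof. by elim: s env w => //= v s IHs env w; apply: grounded_cat2. Qed.

Lemma grounded_and (S : pred var) B1 s w x y :
  {subset paths (size s) x <= S} -> {subset paths (size (shared s B1)) y <= S} ->
  grounded S (and_gates B1 s w x y).
Proof.
elim: s w x y => [|v s IHs] w x y /= Sx Sy.
  have -> : S x := Sx x (mem_head _ _).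
  by have -> : S y := Sy y (mem_head _ _).
apply: grounded_cat2; apply: IHs => z zp.
- by apply: Sx; rewrite mem_cat zp.
- by apply: Sy; move: zp; case: ifP => //= _; rewrite mem_cat => ->.
- by apply: Sx; rewrite mem_cat zp orbT.
- by apply: Sy; move: zp; case: ifP => //= _; rewrite mem_cat orbC => ->.
Qed.

Lemma grounded_trie (S : pred var) X B s w :
  {subset paths (size s) w <= S} -> {in X, forall x, S (inp x)} ->
  grounded S (trie_gates X B s w).
Proof.
move=> + Si; elim: s w => [|v s IHs] w //= Sw.
have Sf : {subset paths (size s) (step false w) <= S}.
  by move=> z zp; apply: Sw; rewrite mem_cat zp.
have St : {subset paths (size s) (step true w) <= S}.
  by move=> z zp; apply: Sw; rewrite mem_cat zp orbT.
rewrite (grounded_cat2 (IHs _ Sf) (IHs _ St)) andbT.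
(* An argument is again a gate of the trie, unless [s] is exhausted; then it is a leaf of the trie
   and lies in [S]. *)
have arg b : (step b w \in map gate_out (trie_gates X B s (step false w) ++
                      trie_gates X B s (step true w))) || S (step b w).
  rewrite map_cat !outs_trie; case: (s) Sf St => [|u s'] Sf St.
    by case: b; [exact: St (mem_head _ _)|exact: Sf (mem_head _ _)].
  by rewrite mem_cat /= !inE; case: b; rewrite eqxx ?orbT.
by case: ifP => [/andP[vX _]|_] /=; rewrite !arg ?Si ?orbT.
Qed.

Lemma outs_local psi X F B w :
  {subset paths (size B) w <= map gate_out (local_gates psi X F B w)}.
Proof.
case: F => [|B1 l r] z /=; rewrite ?outs_leaf // map_cat mem_cat outs_and.
by move=> ->.
Qed.

Lemma outs_forest psi X F B w :
  {subset paths (size B) w <= map gate_out (forest_gates psi X F B w)}.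
Proof.
move=> z zp; have := outs_local psi X F zp.
by case: F => *; rewrite map_cat mem_cat; apply/orP; left.
Qed.

Lemma paths_inner j m w : j <= m ->
  {subset paths j w <= inner_paths m w ++ paths m w}.
Proof.
elim: j m w => [|j IHj] [|m] w //=.
- by move=> _ z.
- by move=> _ z; rewrite inE => /eqP->; exact: mem_head.
- move=> jm z; rewrite !(mem_cat, inE).
  by case/orP=> /(IHj _ _ jm); rewrite mem_cat => /orP[] ->; rewrite ?orbT.
Qed.

Lemma grounded_forest psi X F B w : grounded [in map inp X] (forest_gates psi X F B w).
Proof.
elim: F B w => [|B1 l IHl r IHr] B w; first by rewrite /= cats0 grounded_leaf.
rewrite /= -catA; apply: grounded_cat; last apply: grounded_cat.
- apply: grounded_and => z zp; rewrite unfold_in /= !map_cat !mem_cat.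
    by rewrite (outs_forest psi X r zp) ?orbT.
  (* The gate read for the common variables is an inner node of the trie or, if no variable is
     fresh, a gate of the child. *)
  have le : size (shared B B1) <= size (next_bag B B1) by rewrite size_cat leq_addr.
  have := paths_inner le zp; rewrite mem_cat outs_trie => /orP[->//|].
  by move/(outs_forest psi X l)->; rewrite ?orbT.
- apply: grounded_trie => [z zp|x]; last by move=> xX; rewrite /= map_f ?orbT.
  by rewrite unfold_in /= map_cat mem_cat (outs_forest psi X l zp).
- by apply: grounded_cat2; [exact: IHl|exact: IHr].
Qed.

(** The clause on [size p] is there because the trie leading to a child uses the address of the
    child: its gates are told from those of the child by their shorter assignments. *)
Lemma outs_forest_nm psi X F B a z :
  z \in map gate_out (forest_gates psi X F B (nm a [::])) ->
  exists c p, z = nm (c ++ a) p /\ (c = [::] -> size p = size B).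
Proof.
elim: F B a => [|B1 l IHl r IHr] B a.
  rewrite /= cats0 outs_leaf => /pathsP[p sp ->]; exists [::], p.
  by rewrite cats0.
rewrite /= !map_cat !mem_cat outs_and outs_trie !nm_kid -orbA.
case/or4P => [/pathsP[p sp ->]|/inner_pathsP[p sp ->]
             |/IHl[c [p [-> _]]]|/IHr[c [p [-> _]]]].
- by exists [::], p; rewrite cats0.
- by exists [:: false], p; rewrite cats0.
- by exists (rcons c false), p; rewrite cat_rcons; split=> //; case: c.
- by exists (rcons c true), p; rewrite cat_rcons; split=> //; case: c.
Qed.

Lemma uniq_outs_forest psi X F B a :
  uniq (map gate_out (forest_gates psi X F B (nm a [::]))).
Proof.
elim: F B a => [|B1 l IHl r IHr] B a.
  by rewrite /= cats0 outs_leaf uniq_paths.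
rewrite /= -catA !map_cat outs_and outs_trie !nm_kid.
rewrite cat_uniq uniq_paths cat_uniq uniq_inner_paths cat_uniq IHl IHr !andbT /=.
(* Three reasons for disjointness: the gates of the node have a shorter address than all others, the
   trie has shorter assignments than the child, and the two subtrees differ in a bit of the
   address. *)
apply/and3P; split; apply/hasPn => z.
- rewrite !mem_cat => H; apply/negP => /pathsP[p sp zp].
  have [c [b [p' E]]] : exists c b p', z = nm (c ++ b :: a) p'.
    case/or3P: H => [/inner_pathsP[p' _ ->]|/outs_forest_nm[c [p' [-> _]]]
                    |/outs_forest_nm[c [p' [-> _]]]].
    + by exists [::], false, (p' ++ [::]).
    + by exists c, false, p'.
    + by exists c, true, p'.
  by move: E; rewrite zp => /nm_inj[/(congr1 size)]; rewrite size_cat /=; lia.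
- rewrite mem_cat => H; apply/negP => /inner_pathsP[p sp zp].
  case/orP: H => /outs_forest_nm[c [p' [E]]].
    move: E; rewrite zp cats0 => /nm_inj[/(congr1 size) E <-] H.
    have c0 : c = [::] by apply: size0nil; move: E; rewrite size_cat /=; lia.
    by move: (H c0) sp => ->; rewrite ltnn.
  by move: E; rewrite zp => /nm_inj[/(@cat_cons_inj _ [::]) []].
- move/outs_forest_nm => [c [p [-> _]]]; apply/negP.
  by move/outs_forest_nm => [c' [p' [/nm_inj[/cat_cons_inj[]]]]].
Qed.

(** * Semantics of the gates *)

Arguments circuit_cnf : simpl never.
Arguments sat : simpl never.

(** A clause with a variable outside [B] cannot be violated here, whereas the empty clause is
    violated in every bag, even an empty one. *)
Definition respects psi (tau : var -> bool) (B : seq var) : bool :=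
  all (fun C : clause =>
    ~~ all (fun l : literal => (l.2 \in B) && (tau l.2 != l.1)) C) psi.

Lemma eq_respects psi tau1 tau2 B1 B2 :
  B1 =i B2 -> {in B1, tau1 =1 tau2} -> respects psi tau1 B1 = respects psi tau2 B2.
Proof.
move=> eqB eqt; apply: eq_all => C; congr (~~ _); apply: eq_all => l.
by rewrite -eqB; case: (boolP (l.2 \in B1)) => //= /eqt->.
Qed.

Lemma leaf_sem beta tau psi B w :
  sat beta (circuit_cnf (leaf_gates psi B [::] w)) ->
  beta (path_word (map tau B) w) = respects psi tau B.
Proof.
(* The environment collects the falsified literals in reverse order, hence [catrev]. *)
have gen s env u : sat beta (circuit_cnf (leaf_gates psi s env u)) ->
    beta (path_word (map tau s) u) =
    consistent psi (catrev [seq (~~ tau v, v) | v <- s] env).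
  elim: s env u => [|v s IHs] env u /=.
    by rewrite sat_circuit_cons => /andP[/eqP].
  rewrite sat_circuit_cat => /andP[/IHs Ef /IHs Et].
  by case tv: (tau v); rewrite /= ?Ef ?Et.
move/gen->; apply: eq_all => C; congr (~~ _); apply: eq_all => -[b v].
rewrite catrevE cats0 mem_rev /=; apply/mapP/andP => [[u uB [-> ->]]|[vB]].
  by rewrite uB; case: (tau u).
by move=> tv; exists v => //; move: tv; case: b; case: (tau v).
Qed.

Lemma and_sem beta tau B1 s w x y :
  sat beta (circuit_cnf (and_gates B1 s w x y)) ->
  beta (path_word (map tau s) w) =
  beta (path_word (map tau s) x) && beta (path_word (map tau (shared s B1)) y).
Proof.
elim: s w x y => [|v s IHs] w x y /=.
  by rewrite sat_circuit_cons => /andP[/eqP].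
rewrite sat_circuit_cat => /andP[/IHs Ef /IHs Et].
by case tv: (tau v); rewrite ?Ef ?Et; case: (v \in B1); rewrite //= ?tv.
Qed.

Lemma sat_trie_cat beta tau X B s1 s2 w :
  sat beta (circuit_cnf (trie_gates X B (s1 ++ s2) w)) ->
  sat beta (circuit_cnf (trie_gates X B s2 (path_word (map tau s1) w))).
Proof.
elim: s1 w => //= v s1 IHs1 w; rewrite sat_circuit_cons sat_circuit_cat.
by case: (tau v) => /and3P[_ /IHs1 + /IHs1].
Qed.

Definition update (tau : var -> bool) v b : var -> bool :=
  fun u => if u == v then b else tau u.

Lemma trie_sem beta tau X B s w :
  sat beta (circuit_cnf (trie_gates X B s w)) ->
  uniq s -> {in s, forall v, v \notin B} ->
  beta w <->
  exists tau1, [/\ forall v, v \notin s -> tau1 v = tau v,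
                   {in s, forall v, v \in X -> tau1 v = beta (inp v)}
                 & beta (path_word (map tau1 s) w)].
Proof.
elim: s w tau => [|v s IHs] w tau /=.
  by move=> _ _ _; split=> [bw|[tau1 [_ _]] //]; exists tau.
rewrite sat_circuit_cons sat_circuit_cat => /and3P[Hg Sf St] /andP[vs us] sB.
have sB' : {in s, forall u, u \notin B}.
  by move=> u us'; apply: sB; rewrite inE us' orbT.
have vB : v \notin B by apply: sB; rewrite mem_head.
have IH b : beta (step b w) <-> exists tau1,
   [/\ forall u, u \notin s -> tau1 u = update tau v b u,
       {in s, forall u, u \in X -> tau1 u = beta (inp u)}
     & beta (path_word (map tau1 s) (step b w))].
  by case: b; [apply: (IHs _ _ St)|apply: (IHs _ _ Sf)].
(* Both kinds of gate say that some admissible value of [v] works: a disjunction admits both values,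
   a multiplexer only that of the input. Since [v] is not in [B], membership in [X] alone decides
   which gate is present. *)
have -> : beta w <-> exists2 b, (v \in X -> b = beta (inp v)) & beta (step b w).
  move: Hg; rewrite vB andbT; case: ifP => /= vX /eqP->.
    split=> [H|[b -> //]].
      by exists (beta (inp v)) => //; move: H; case: (beta (inp v)).
    by case: (beta (inp v)).
  split=> [/orP[]|[[] _ ->]]; rewrite ?orbT //.
    by exists false.
  by exists true.
split=> [[b bX /IH[tau1 [H1 H2 H3]]]|[tau1 [H1 H2 H3]]].
  have tv : tau1 v = b by rewrite H1 // /update eqxx.
  exists tau1; split; last by rewrite tv.
    by move=> u; rewrite inE negb_or => /andP[/negbTE uv /H1->]; rewrite /update uv.
  by move=> u; rewrite inE => /orP[/eqP->|/H2//]; rewrite tv.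
exists (tau1 v); first by move=> vX; apply: H2; rewrite ?mem_head.
apply/IH; exists tau1; split=> //; last first.
  by move=> u us' uX; apply: H2; rewrite // inE us' orbT.
move=> u us'; rewrite /update; case: eqP => [->//|/eqP uv].
by apply: H1; rewrite inE negb_or uv.
Qed.

Definition btree_vars (F : btree) : seq var := flatten (btree_bags F).

(* What the connectedness of the bags says locally: the subtree at a child meets
   the bag B of its parent only inside the child's bag, and meets its later
   siblings only inside B. *)
Fixpoint coherent (B : seq var) (F : btree) : Prop :=
  if F is Node B1 l r then
    [/\ forall v, v \in B1 ++ btree_vars l -> v \in B -> v \in B1,
        forall v, v \in B1 ++ btree_vars l -> v \in btree_vars r -> v \in B,
        coherent B1 l & coherent B r]
  else True.

Lemma eq_coherent B B' F : B =i B' -> coherent B F -> coherent B' F.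
Proof.
move=> eqB; elim: F B B' eqB => //= B1 l IHl r IHr B B' eqB [H1 H2 Hl Hr].
split=> // [v vl|v vl vr|]; last exact: IHr Hr.
  by rewrite -eqB; exact: H1.
by rewrite -eqB; exact: H2 vr.
Qed.

(** Variables of [X] inside [B] are not yet tied to the inputs [sigma]: [tau] ranges over all
    assignments of [B], and such a variable is tied where it is eliminated, above the topmost bag
    containing it. *)
Definition witness psi (X : seq var) F (B : seq var)
    (sigma tau tau' : var -> bool) : Prop :=
  [/\ {in B, tau' =1 tau},
      forall v, v \in btree_vars F -> v \in X -> v \notin B -> tau' v = sigma v
    & {in B :: btree_bags F, forall D, respects psi tau' D}].

Lemma sub_btree_vars D F : D \in btree_bags F -> {subset D <= btree_vars F}.
Proof. by move=> DF v vD; apply/flattenP; exists D. Qed.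

Lemma btree_vars_node B l r :
  btree_vars (Node B l r) = (B ++ btree_vars l) ++ btree_vars r.
Proof. by rewrite /btree_vars /= flatten_cat catA. Qed.

(** From left to right one valuation serves both parts. Conversely the parts have to be glued, and
    [coherent] confines their overlap to [B] and [B1], where both follow [tau]. *)
Lemma witness_node psi X B1 l r B sigma tau :
  coherent B (Node B1 l r) ->
  (exists tau', witness psi X (Node B1 l r) B sigma tau tau') <->
  (exists tau', witness psi X r B sigma tau tau') /\
  (exists tau1, [/\ {in shared B B1, tau1 =1 tau},
                    {in fresh B B1, forall v, v \in X -> tau1 v = sigma v}
                  & exists tau', witness psi X l B1 sigma tau1 tau']).
Proof.
move=> /= [c1 c2 _ _]; split=> [[t [tB tX tR]]|].
  split; first exists t; last (exists t; split; last exists t); first split=> //.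
  - by move=> v vr; apply: tX; rewrite btree_vars_node mem_cat vr orbT.
  - move=> D; rewrite inE => /orP[DB|Dr]; apply: tR.
      by rewrite inE DB.
    by rewrite !inE mem_cat Dr !orbT.
  - by move=> v; rewrite mem_filter => /andP[_ /tB].
  - move=> v; rewrite mem_undup mem_filter => /andP[vB vB1] vX; apply: tX => //.
    by rewrite btree_vars_node !mem_cat vB1.
  - split=> // [v vl vX vB1|D DB1].
      apply: tX => //; first by rewrite btree_vars_node !mem_cat vl orbT.
      by apply: contra vB1; apply: c1; rewrite mem_cat vl orbT.
    by apply: tR; move: DB1; rewrite !inE mem_cat => /orP[->|->]; rewrite ?orbT.
move=> [[t2 [t2B t2X t2R]] [t1 [t1B t1X [t [tB1 tX tR]]]]].
have tsh v : v \in B -> v \in B1 -> t v = tau v.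
  by move=> vB vB1; rewrite tB1 // t1B // mem_filter vB1.
(* The child's valuation is used on all variables of its subtree, the siblings' valuation elsewhere.
   A variable of [U] met in [B] or in a later bag lies in both [B] and [B1]. *)
pose U := B1 ++ btree_vars l.
pose t' v := if v \in U then t v else t2 v.
exists t'; split.
- move=> v vB; rewrite /t'; case: ifP => [vU|_]; last exact: t2B.
  by apply: tsh => //; exact: c1 vU vB.
- move=> v; rewrite btree_vars_node mem_cat /t' -/U => vF vX vB.
  case: ifP vF => [|_ /= vr]; last exact: t2X.
  rewrite mem_cat; case: (boolP (v \in B1)) => [vB1 _ _|vB1 /= vl _].
    by rewrite tB1 // t1X // mem_undup mem_filter vB.
  exact: tX.
have left_ok : {in B1 :: btree_bags l, forall D, respects psi t' D}.
  move=> D DB1; apply: etrans (tR D DB1); apply: eq_respects => // v vD.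
  rewrite /t' ifT // mem_cat; move: DB1; rewrite inE => /orP[/eqP<-|/sub_btree_vars H].
    by rewrite vD.
  by rewrite H ?orbT.
have right_ok : {in B :: btree_bags r, forall D, respects psi t' D}.
  move=> D DB; apply: etrans (t2R D DB); apply: eq_respects => // v vD.
  rewrite /t'; case: ifP => // vU.
  have vB : v \in B.
    move: DB; rewrite inE => /orP[/eqP<-//|/sub_btree_vars H].
    by apply: c2 vU _; exact: H.
  by rewrite (tsh v vB (c1 v vU vB)) t2B.
move=> D; rewrite !inE mem_cat => /or4P[DB|DB1|Dl|Dr].
- by apply: right_ok; rewrite inE DB.
- by apply: left_ok; rewrite inE DB1.
- by apply: left_ok; rewrite inE Dl orbT.
- by apply: right_ok; rewrite inE Dr orbT.
Qed.

Lemma eq_witness psi X F B B' sigma tau tau' :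
  B =i B' -> witness psi X F B sigma tau tau' -> witness psi X F B' sigma tau tau'.
Proof.
move=> eqB [HB HX HR]; split.
- by move=> v; rewrite -eqB => /HB.
- by move=> v vF vX; rewrite -eqB; exact: HX.
move=> D; rewrite inE => /orP[/eqP->|DF].
  by rewrite -(@eq_respects _ tau' _ B B') // HR ?mem_head.
by apply: HR; rewrite inE DF orbT.
Qed.

Lemma forest_sem psi X beta F B w tau :
  coherent B F -> uniq B -> sat beta (circuit_cnf (forest_gates psi X F B w)) ->
  beta (path_word (map tau B) w) <->
  exists tau', witness psi X F B (beta \o inp) tau tau'.
Proof.
elim: F B w tau => [|B1 l IHl r IHr] B w tau cF uB.
  rewrite /= cats0 => /leaf_sem->; split=> [ok|[tau' [HB _ HR]]].
    by exists tau; split=> // D; rewrite inE => /eqP->.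
  by rewrite -(@eq_respects _ tau' _ B B) // HR ?mem_head.
rewrite /= !sat_circuit_cat -andbA => /and4P[/and_sem Hand Htrie Hl Hr].
have [_ _ cl cr] := cF.
have cl' : coherent (next_bag B B1) l.
  by apply: eq_coherent cl => v; rewrite mem_next_bag.
rewrite (witness_node _ _ _ _ cF) Hand -(rwP andP).
rewrite (IHr _ _ _ cr uB Hr).
have ufr : uniq (fresh B B1) by exact: undup_uniq.
have fB : {in fresh B B1, forall v, v \notin B}.
  by move=> v; rewrite mem_undup mem_filter => /andP[].
rewrite (trie_sem tau (sat_trie_cat tau Htrie) ufr fB).
have IH tau1 : {in shared B B1, tau1 =1 tau} ->
    beta (path_word (map tau1 (fresh B B1))
            (path_word (map tau (shared B B1)) (kid false w))) <->
    exists tau', witness psi X l B1 (beta \o inp) tau1 tau'.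
  move=> /eq_in_map <-; rewrite /path_word -foldl_cat -map_cat.
  apply: (iff_trans (IHl _ _ tau1 cl' (uniq_next_bag B1 uB) Hl)).
  by split=> -[t W]; exists t; apply: eq_witness W => v; rewrite mem_next_bag.
split=> -[H2 [tau1 [H3 H4 H5]]]; split=> //.
  have H3' : {in shared B B1, tau1 =1 tau}.
    move=> v; rewrite mem_filter => /andP[_ vB].
    by apply: H3; apply: contraL vB => /fB.
  by exists tau1; split=> //; exact/(IH _ H3').
(* [witness_node] controls [tau1] only on [B1], while [trie_sem] asks for agreement with [tau] at
   all variables that are not fresh. On [B1] nothing changes, so the same extension remains a
   witness. *)
pose tau2 v := if v \in fresh B B1 then tau1 v else tau v.
have sh2 : {in shared B B1, tau2 =1 tau}.
  move=> v; rewrite mem_filter /tau2 => /andP[_ vB].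
  by case: ifP => // /fB; rewrite vB.
exists tau2; split=> [v /negbTE vf|v vf vX|]; rewrite /tau2 ?vf //.
  exact: H4.
apply/(IH _ sh2); case: H5 => t [tB tX tR]; exists t; split=> // v vB1.
rewrite tB // /tau2; case: ifP => // vf; apply: H3.
by move: vf; rewrite mem_undup !mem_filter vB1 andbT; case: (v \in B).
Qed.

(** * From tree decompositions to local consistency *)

Lemma helly B F (S : seq var) :
  coherent B F ->
  {in S &, forall u v, exists D, [/\ D \in B :: btree_bags F, u \in D & v \in D]} ->
  exists2 D, D \in B :: btree_bags F & {subset S <= D}.
Proof.
elim: F B => [|B1 l IHl r IHr] B cF pair.
  exists B; rewrite ?mem_head // => u uS.
  by have [D []] := pair u u uS uS; rewrite inE => /eqP->.
have [c1 c2 cl cr] := cF.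
pose U := B1 ++ btree_vars l.
have leftU D : D \in B1 :: btree_bags l -> {subset D <= U}.
  rewrite inE => /orP[/eqP->|/sub_btree_vars DU] v vD; rewrite mem_cat ?vD //.
  by rewrite DU ?orbT.
have right D : D \in B :: btree_bags r -> {subset D <= B ++ btree_vars r}.
  rewrite inE => /orP[/eqP->|/sub_btree_vars DU] v vD; rewrite mem_cat ?vD //.
  by rewrite DU ?orbT.
have split D : D \in B :: btree_bags (Node B1 l r) ->
    D \in B1 :: btree_bags l \/ D \in B :: btree_bags r.
  rewrite !inE mem_cat => /or4P[->|->|->|->]; rewrite ?orbT; by [left|right].
have c12 v : v \in U -> v \in B ++ btree_vars r -> v \in B.
  by move=> vU; rewrite mem_cat => /orP[//|]; exact: c2.
have sub1 D : D \in B1 :: btree_bags l -> D \in B :: btree_bags (Node B1 l r).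
  by rewrite !inE mem_cat => /orP[->|->]; rewrite ?orbT.
have sub2 D : D \in B :: btree_bags r -> D \in B :: btree_bags (Node B1 l r).
  by rewrite !inE mem_cat => /orP[->|->]; rewrite ?orbT.
(* If [S] lies in the left part, a pair met in a right-hand bag is contained in [B] and hence in
   [B1], so the left subtree already covers all pairs. *)
case: (boolP (all [in U] S)) => [/allP SU|/allPn[x xS xU]].
  have [|D Dl SD] := IHl B1 cl; last by exists D => //; exact: sub1.
  move=> u v uS vS; have [D [/split[Dl|Dr] uD vD]] := pair u v uS vS.
    by exists D.
  exists B1; rewrite mem_head; split=> //; apply: c1; try exact: SU.
    by apply: c12; [exact: SU|exact: right uD].
  by apply: c12; [exact: SU|exact: right vD].
(* Every member of [S] shares a bag with [x], and such a bag is on the right. Pairs met on the left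
   are then contained in [B]. *)
have SB : {subset S <= B ++ btree_vars r}.
  move=> v vS; have [D [/split[/leftU Dl xD|/right Dr _] vD]] := pair x v xS vS.
    by rewrite (Dl x xD) in xU.
  exact: Dr.
have [|D Dr SD] := IHr B cr; last by exists D => //; exact: sub2.
move=> u v uS vS; have [D [/split[/leftU Dl|Dr] uD vD]] := pair u v uS vS.
  exists B; rewrite mem_head; split=> //; apply: c12; try exact: SB; exact: Dl.
by exists D.
Qed.

Lemma bag_tree_ind2 (P : bag_tree -> Prop) :
  (forall B ts, foldr (fun t Q => P t /\ Q) True ts -> P (BagNode B ts)) ->
  forall T, P T.
Proof.
move=> IH; fix F 1 => -[B ts]; apply: IH.
by elim: ts => //= t ts IHts; split.
Qed.

Fixpoint lcrs (T : bag_tree) (sibs : btree) : btree :=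
  let: BagNode B ts := T in Node B (foldr lcrs Leaf ts) sibs.

Lemma enc_lcrs ts : enc_btree (foldr lcrs Leaf ts) = enc_seq enc_bag_tree ts.
Proof.
have gen T r : enc_btree (lcrs T r) = Pair (enc_bag_tree T) (enc_btree r).
  elim/bag_tree_ind2: T r => B us IH r /=; congr (Pair (Pair _ _) _).
  by elim: us IH => //= t us IHus [IHt /IHus <-]; rewrite IHt.
by elim: ts => //= t ts <-; rewrite gen.
Qed.

Lemma bags_lcrs ts : btree_bags (foldr lcrs Leaf ts) = flatten (map bags ts).
Proof.
have gen T r : btree_bags (lcrs T r) = bags T ++ btree_bags r.
  elim/bag_tree_ind2: T r => B us IH r /=; congr (_ :: _ ++ _).
  by elim: us IH => //= t us IHus [IHt /IHus <-]; rewrite IHt.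
by elim: ts => //= t ts <-; rewrite gen.
Qed.

Lemma bag_at_empty p : bag_at (BagNode [::] [::]) p = [::].
Proof. by elim: p => //= i p; rewrite nth_nil. Qed.

Lemma bag_at_bags T p v : v \in bag_at T p -> exists2 D, D \in bags T & v \in D.
Proof.
elim: p T => [|i p IHp] [B ts] /=; first by exists B; rewrite ?mem_head.
case: (ltnP i (size ts)) => [lti|gei]; last first.
  by rewrite nth_default // bag_at_empty.
move=> /IHp[D Dt vD]; exists D => //; rewrite inE; apply/orP; right.
apply/flattenP; exists (bags (nth (BagNode [::] [::]) ts i)) => //.
by rewrite -(nth_map _ [::]) // mem_nth ?size_map.
Qed.

Lemma bags_bag_at T v : v \in flatten (bags T) -> exists p, v \in bag_at T p.
Proof.
elim/bag_tree_ind2: T => B ts IH /=; rewrite mem_cat => /orP[vB|].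
  by exists [::].
suff: v \in flatten (flatten (map bags ts)) ->
    exists i p, v \in bag_at (nth (BagNode [::] [::]) ts i) p.
  by move=> H /H[i [p vp]]; exists (i :: p).
elim: ts IH => //= t ts IHts [IHt /IHts H]; rewrite flatten_cat mem_cat.
case/orP=> [/IHt[p vp]|/H[i [p vp]]]; first by exists 0, p.
by exists i.+1, p.
Qed.

(** A step between neighbours changes an address only at its end, so the subtree at [rcons a i] can
    be left only along the edge from [rcons a i] to [a], and the walk contains both ends of it. *)
Lemma walk_exit (T : bag_tree) v a i p s :
  path node_adj p s -> all (fun r => v \in bag_at T r) s -> v \in bag_at T p ->
  prefix (rcons a i) p -> ~~ prefix (rcons a i) (last p s) ->
  v \in bag_at T (rcons a i) /\ v \in bag_at T a.
Proof.
elim: s p => [|r s IHs] p /=; first by move=> _ _ _ ->.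
move=> /andP[adj walk] /andP[vr vs] vp ap ends.
case: (boolP (prefix (rcons a i) r)) => [ar|nar]; first exact: IHs ar ends.
case/orP: adj => /andP[ne /eqP E].
  case/negP: nar; apply: prefix_trans ap _; rewrite E; exact: prefix_take.
have take_rcons (x : seq nat) z : take (size (rcons x z)).-1 (rcons x z) = x.
  by rewrite size_rcons -cats1 take_size_cat.
case/prefixP: ap E vp nar => y ->.
case/lastP: y => [|y z]; first by rewrite cats0 take_rcons => <-.
by rewrite -rcons_cat take_rcons => ->; rewrite prefix_prefix.
Qed.

Definition separated (T : bag_tree) (v : var) : Prop :=
  forall a i q r, v \in bag_at T (a ++ i :: q) -> v \in bag_at T r ->
    ~~ prefix (rcons a i) r -> v \in bag_at T (rcons a i) /\ v \in bag_at T a.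

Lemma connected_separated T v : bags_connected T v -> separated T v.
Proof.
move=> conn a i q r vp vr nar; have [s [walk lst vs]] := conn _ _ vp vr.
apply: (walk_exit walk vs vp); last by rewrite lst.
by rewrite -cat_rcons prefix_prefix.
Qed.

Lemma separated_child B ts v i :
  separated (BagNode B ts) v -> separated (nth (BagNode [::] [::]) ts i) v.
Proof.
move=> sep a j q r vp vr nar; apply: (sep (i :: a) j q (i :: r)) => //=.
by rewrite eqxx.
Qed.

Lemma coherent_lcrs T :
  (forall v, separated T v) ->
  let: BagNode B ts := T in coherent B (foldr lcrs Leaf ts).
Proof.
elim/bag_tree_ind2: T => B ts IH sep.
have {IH}: foldr (fun t Q => (let: BagNode B1 us := t in
    coherent B1 (foldr lcrs Leaf us)) /\ Q) True ts.
  have: forall i v, separated (nth (BagNode [::] [::]) ts i) v.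
    by move=> i v; apply: separated_child (sep v).
  elim: ts IH {sep} => //= t ts IHts [IHt H] sep; split.
    by apply: IHt => v; apply: (sep 0).
  by apply: IHts => // i v; apply: (sep i.+1).
(* Coherence consumes the list of children from the front, whereas addresses count from the first
   child; the prefix [us] records the offset. *)
have: forall us t, ts = us ++ t -> foldr (fun t Q => (let: BagNode B1 us := t in
    coherent B1 (foldr lcrs Leaf us)) /\ Q) True t -> coherent B (foldr lcrs Leaf t).
  move=> us t; elim: t us => // -[B1 ws] t IHt us E [c1 ct] /=.
  have nthE j : nth (BagNode [::] [::]) ts (size us + j) =
                nth (BagNode [::] [::]) (BagNode B1 ws :: t) j.
    by rewrite E nth_cat ltnNge leq_addr /= addKn.
  have inU v : v \in B1 ++ btree_vars (foldr lcrs Leaf ws) ->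
      exists q, v \in bag_at (BagNode B ts) (size us :: q).
    rewrite /btree_vars bags_lcrs => vU; have [|q vq] := @bags_bag_at (BagNode B1 ws) v.
      exact: vU.
    by exists q; move: vq; rewrite /= -[size us]addn0 nthE.
  have bag1 : bag_at (BagNode B ts) [:: size us] = B1.
    by rewrite /= -[size us]addn0 nthE.
  split=> // [v /inU[q vq] vB|v /inU[q vq]|].
  - by have [] := @sep v [::] (size us) q [::] vq vB isT; rewrite -bag1.
  - rewrite /btree_vars bags_lcrs => vt.
    (* The remaining children are hung below an auxiliary empty bag to obtain an address; the bag
       being empty, the address is not the root. *)
    have [|q' vq'] := @bags_bag_at (BagNode [::] t) v; first exact: vt.
    case: q' vq' => [//|j q'] vq'.
    have {}vq' : v \in bag_at (BagNode B ts) ((size us + j.+1) :: q').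
      by move: vq'; rewrite /= nthE.
    have [] := @sep v [::] (size us) q _ vq vq' _ => //=.
    by rewrite negb_and; apply/orP; left; apply/eqP; lia.
  - by apply: (IHt (rcons us (BagNode B1 ws))); rewrite ?cat_rcons.
by move=> H; apply: (H [::]).
Qed.

(** The empty bag above the root shares nothing with the tree, so only the coherence below the root
    is in question. Variables outside [V] occur in no bag and are separated vacuously. *)
Lemma td_coherent V E T :
  tree_decomposition V E T -> coherent [::] (lcrs T Leaf).
Proof.
case=> sub _ _ conn; case: T sub conn => B ts sub conn; split=> //.
apply: (@coherent_lcrs (BagNode B ts)) => v.
case: (boolP (v \in V)) => [/conn|vV]; first exact: connected_separated.
move=> a i q r /bag_at_bags[D DT vD]; case/negP: vV.
exact: sub vD.
Qed.

Lemma btree_bags_lcrs T : btree_bags (lcrs T Leaf) = bags T.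
Proof. by have := bags_lcrs [:: T]; rewrite /= cats0. Qed.

Lemma mem_vars (psi : cnf) (C : clause) (l : literal) :
  C \in psi -> l \in C -> l.2 \in vars psi.
Proof.
move=> Cpsi lC; rewrite mem_undup; apply/flattenP; exists (clause_vars C).
  exact: map_f.
exact: map_f.
Qed.

Lemma clause_in_bag (psi : cnf) T (C : clause) :
  tree_decomposition (vars psi) (primal_edge psi) T -> C \in psi ->
  exists2 D, D \in [::] :: bags T & {subset clause_vars C <= D}.
Proof.
move=> td Cpsi; rewrite -btree_bags_lcrs; apply: helly (td_coherent td) _.
move=> u v uC vC; rewrite btree_bags_lcrs; have [_ cov edge _] := td.
have inV x : x \in clause_vars C -> x \in vars psi.
  by move=> /mapP[l lC ->]; apply: mem_vars lC.
case: (altP (u =P v)) => [<-|uv].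
  by have [D DT uD] := cov u (inV u uC); exists D; rewrite inE DT orbT.
have [|D DT /andP[uD vD]] := edge u v (inV u uC) (inV v vC).
  by rewrite /primal_edge uv; apply/hasP; exists C; rewrite ?uC.
by exists D; rewrite inE DT orbT.
Qed.

Lemma respects_sat psi T tau :
  tree_decomposition (vars psi) (primal_edge psi) T ->
  {in [::] :: bags T, forall D, respects psi tau D} <-> sat tau psi.
Proof.
move=> td; split=> [ok|/allP ok D _].
  apply/allP => C Cpsi; have [D DT CD] := clause_in_bag td Cpsi.
  have /allPn[l lC] := allP (ok D DT) C Cpsi.
  by rewrite CD ?map_f //= negbK => tl; apply/hasP; exists l.
apply/allP => C /ok /hasP[l lC tl]; apply/allPn; exists l => //.
by rewrite tl andbF.
Qed.

Lemma root_sem psi X T beta w :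
  {subset X <= vars psi} ->
  tree_decomposition (vars psi) (primal_edge psi) T ->
  sat beta (circuit_cnf (forest_gates psi X (lcrs T Leaf) [::] w)) ->
  beta w <-> exists2 tau, {in X, forall x, tau x = beta (inp x)} & sat tau psi.
Proof.
move=> XV td sb; have := forest_sem (fun=> false) (td_coherent td) isT sb.
rewrite /= => ->; rewrite /witness btree_bags_lcrs; split=> -[tau].
  case=> _ tX /(respects_sat _ td) ts; exists tau => // x xX; apply: tX => //.
  rewrite /btree_vars btree_bags_lcrs; apply/flattenP.
  by have [_ cov _ _] := td; have [D] := cov x (XV x xX); exists D.
move=> tX /(respects_sat _ td) ts; exists tau; split=> // x _ xX _; exact: tX.
Qed.

(** * The output tree decomposition *)

Definition tree_paths m w := inner_paths m w ++ paths m w.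

Lemma tree_pathsP m a q z : z \in tree_paths m (nm a q) -> exists p, z = nm a p.
Proof.
by rewrite mem_cat => /orP[/inner_pathsP|/pathsP] [p _ ->]; exists (p ++ q).
Qed.

Lemma mem_tree_paths m w : w \in tree_paths m w.
Proof. by case: m => [|m]; rewrite mem_head. Qed.

Lemma args_leaf psi s env w :
  flatten (map gate_args (leaf_gates psi s env w)) = [::].
Proof. by elim: s env w => //= v s IHs env w; rewrite map_cat flatten_cat !IHs. Qed.

Lemma args_and B1 s w x y z :
  z \in flatten (map gate_args (and_gates B1 s w x y)) ->
  (z \in paths (size s) x) || (z \in paths (size (shared s B1)) y).
Proof.
elim: s w x y => [|v s IHs] w x y /=; first by rewrite !inE.
rewrite map_cat flatten_cat mem_cat => /orP[] /IHs; case: (v \in B1) => /=;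
  by rewrite !mem_cat => /orP[] ->; rewrite ?orbT.
Qed.

Definition muxed (X B s : seq var) : seq var := [seq v <- s | (v \in X) && (v \notin B)].

Lemma args_trie X B s w z :
  z \in flatten (map gate_args (trie_gates X B s w)) ->
  z \in tree_paths (size s) w ++ map inp (muxed X B s).
Proof.
elim: s w => // v s IHs w.
rewrite [trie_gates _ _ _ _]/= [flatten _]/= mem_cat map_cat flatten_cat mem_cat.
have step_in b : step b w \in tree_paths (size s).+1 w ++ map inp (muxed X B (v :: s)).
  rewrite mem_cat; apply/orP; left.
  have := mem_tree_paths (size s) (step b w).
  by rewrite /tree_paths /= !(inE, mem_cat) => /orP[]; case: b => ->; rewrite ?orbT.
have sub b : z \in tree_paths (size s) (step b w) ++ map inp (muxed X B s) ->
    z \in tree_paths (size s).+1 w ++ map inp (muxed X B (v :: s)).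
  rewrite mem_cat => /orP[|/mapP[u]].
    rewrite /tree_paths /= !(inE, mem_cat) => /orP[]; case: b => ->; by rewrite ?orbT.
  rewrite mem_filter => /andP[uX us] ->; rewrite mem_cat map_f ?orbT //.
  by rewrite mem_filter uX inE us orbT.
case/or3P => [|/IHs/sub//|/IHs/sub//].
case: ifP => [vX|_]; rewrite [gate_args _]/= !inE.
  case/or3P => /eqP->; [|exact: step_in|exact: step_in].
  by rewrite mem_cat map_f ?orbT // mem_filter vX mem_head.
by case/orP=> /eqP->; exact: step_in.
Qed.

Lemma inp_trie X B s w v :
  v \in muxed X B s -> inp v \in flatten (map gate_args (trie_gates X B s w)).
Proof.
rewrite mem_filter => /andP[vX]; elim: s w => //= u s IHs w.
rewrite inE map_cat flatten_cat !mem_cat => /orP[/eqP E|/IHs->].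
  by move: vX; rewrite E => -> /=; rewrite mem_head.
by rewrite orbT.
Qed.

Definition local_names X F B w : seq var :=
  if F is Node B1 _ _ then
    paths (size B) w ++ paths (size B) (kid true w) ++
    tree_paths (size (next_bag B B1)) (kid false w) ++
    map inp (muxed X B (next_bag B B1))
  else paths (size B) w.

Lemma mem_local_names psi X F B w :
  {subset bag_of (circuit_cnf (local_gates psi X F B w)) <= local_names X F B w}.
Proof.
move=> z; rewrite mem_bag_circuit; case: F => [|B1 l r] /=.
  by rewrite outs_leaf args_leaf orbF.
rewrite !map_cat flatten_cat outs_and outs_trie /tree_paths !mem_cat.
case/orP => [/orP[->|->]|/orP[/args_and/orP[->|zy]|/args_trie]]; rewrite ?orbT //.
- have le : size (shared B B1) <= size (next_bag B B1) by rewrite size_cat leq_addr.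
  by have := paths_inner le zy; rewrite mem_cat => /orP[->|->]; rewrite ?orbT.
- by rewrite /tree_paths !mem_cat => /orP[/orP[->|->]|->]; rewrite ?orbT.
Qed.

Lemma size_paths m w : size (paths m w) = 2 ^ m.
Proof. by elim: m w => //= m IHm w; rewrite size_cat !IHm expnS; lia. Qed.

Lemma size_inner_paths m w : size (inner_paths m w) = (2 ^ m).-1.
Proof.
elim: m w => //= m IHm w; rewrite size_cat !IHm expnS.
by have := expn_gt0 2 m; lia.
Qed.

(** In units of [2 ^ m]: one for the gates of the node, one for those of the remaining siblings, two
    for the trie with its leaves, and one for the inputs, of which there are at most [m]. *)
Lemma size_local_names X F (B : seq var) w m :
  uniq B -> size B <= m ->
  {in btree_bags F, forall B1, size (undup B1) <= m} ->
  size (local_names X F B w) <= 5 * 2 ^ m.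
Proof.
move=> uB leB; have pB := leq_pexp2l (ltn0Sn 1) leB.
case: F => [|B1 l r] leF /=.
  by rewrite size_paths; apply: leq_trans pB _; rewrite leq_pmull.
have leB1 : size (next_bag B B1) <= m by rewrite size_next_bag // leF ?mem_head.
move: (next_bag B B1) leB1 => N leN; have pN := leq_pexp2l (ltn0Sn 1) leN.
have lemux : size (muxed X B N) <= 2 ^ m.
  rewrite size_filter; apply: leq_trans (count_size _ _) _.
  by apply: leq_trans leN _; apply: ltnW; exact: ltn_expl.
rewrite /tree_paths !size_cat size_map size_inner_paths !size_paths.
by move: pB pN lemux; set a := 2 ^ _; set b := 2 ^ _; set c := 2 ^ _;
  set d := size (muxed _ _ _); lia.
Qed.

Lemma size_forest_bags psi X F B w m :
  uniq B -> size B <= m ->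
  {in btree_bags F, forall B1, size (undup B1) <= m} ->
  {in bags (forest_tree psi X F B w), forall D, size (undup D) <= 5 * 2 ^ m}.
Proof.
have root F' B' w' : uniq B' -> size B' <= m ->
    {in btree_bags F', forall B1, size (undup B1) <= m} ->
    size (undup (bag_of (circuit_cnf (local_gates psi X F' B' w')))) <= 5 * 2 ^ m.
  move=> uB leB leF; apply: leq_trans (size_local_names X w' uB leB leF).
  apply: uniq_leq_size (undup_uniq _) _ => z; rewrite mem_undup.
  exact: mem_local_names.
elim: F B w => [|B1 l IHl r IHr] B w uB leB leF D.
  by rewrite inE => /eqP->; exact: root.
rewrite [bags _]/= cats0 inE mem_cat => /or3P[/eqP->|Dl|Dr].
  exact: (root (Node B1 l r)).
  apply: IHl Dl; first exact: uniq_next_bag.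
    by rewrite size_next_bag // leF ?mem_head.
  by move=> E El; apply: leF; rewrite inE mem_cat El orbT.
apply: IHr Dr => // E Er; apply: leF; by rewrite inE mem_cat Er !orbT.
Qed.

Lemma forest_gates_node psi X B1 l r B w :
  forest_gates psi X (Node B1 l r) B w =
  local_gates psi X (Node B1 l r) B w ++
  forest_gates psi X l (next_bag B B1) (kid false w) ++
  forest_gates psi X r B (kid true w).
Proof. by []. Qed.

Lemma forest_bags_node psi X B1 l r B w :
  bags (forest_tree psi X (Node B1 l r) B w) =
  bag_of (circuit_cnf (local_gates psi X (Node B1 l r) B w)) ::
  bags (forest_tree psi X l (next_bag B B1) (kid false w)) ++
  bags (forest_tree psi X r B (kid true w)).
Proof. by rewrite /= cats0. Qed.

Lemma forest_bags_sub psi X F B w D :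
  D \in bags (forest_tree psi X F B w) ->
  {subset D <= bag_of (circuit_cnf (forest_gates psi X F B w))}.
Proof.
elim: F B w => [|B1 l IHl r IHr] B w.
  by rewrite [bags _]/= inE => /eqP->; rewrite /= cats0.
rewrite forest_bags_node forest_gates_node !circuit_cnf_cat !bag_of_cat.
rewrite inE mem_cat; case/or3P => [/eqP->|/IHl Dl|/IHr Dr] z; rewrite !mem_cat.
- by move=> ->.
- by move=> /Dl->; rewrite orbT.
- by move=> /Dr->; rewrite !orbT.
Qed.

Lemma forest_clause_bag psi X F B w C :
  C \in circuit_cnf (forest_gates psi X F B w) ->
  exists2 D, D \in bags (forest_tree psi X F B w) & {subset clause_vars C <= D}.
Proof.
have inbag K : C \in K -> {subset clause_vars C <= bag_of K}.
  by move=> CK z zC; apply/flattenP; exists (clause_vars C) => //; apply: map_f.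
elim: F B w => [|B1 l IHl r IHr] B w.
  rewrite /= cats0 => CK; exists (bag_of (circuit_cnf (leaf_gates psi B [::] w))).
    exact: mem_head.
  exact: inbag.
rewrite forest_gates_node circuit_cnf_cat.
rewrite (circuit_cnf_cat (forest_gates _ _ _ _ _)) 2!mem_cat forest_bags_node.
case/or3P => [CK|/IHl[D Dl CD]|/IHr[D Dr CD]].
- exists (bag_of (circuit_cnf (local_gates psi X (Node B1 l r) B w))).
    exact: mem_head.
  exact: inbag.
- by exists D => //; rewrite inE mem_cat Dl orbT.
- by exists D => //; rewrite inE mem_cat Dr !orbT.
Qed.

(** An input absent from the output would not be counted. Below [B] the variable is eliminated at
    its topmost bag, and since it is in [X] this emits a multiplexer that mentions it. *)
Lemma inp_forest psi X F B w v :
  v \in X -> v \in btree_vars F -> v \notin B ->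
  inp v \in bag_of (circuit_cnf (forest_gates psi X F B w)).
Proof.
move=> vX; elim: F B w => // B1 l IHl r IHr B w.
rewrite btree_vars_node mem_cat mem_cat [forest_gates _ _ _ _ _]/=.
rewrite !circuit_cnf_cat !bag_of_cat !mem_cat => vF vB.
case: (boolP (v \in B1)) vF => [vB1 _|vB1 /orP[vl|vr]].
- rewrite (mem_bag_circuit (trie_gates _ _ _ _)) inp_trie ?orbT //.
  by rewrite mem_filter vX vB mem_next_bag.
- by rewrite IHl ?orbT // mem_next_bag.
- by rewrite IHr ?orbT.
Qed.

(* q is the topmost node of F whose bag contains v, and v is not in B: the only
   node where v is eliminated, hence the only output bag with the input of v. *)
Fixpoint top_at (B : seq var) (F : btree) (q : seq bool) (v : var) : bool :=
  if F is Node B1 l r then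
    match q with
    | [::] => (v \in B1) && (v \notin B)
    | false :: q' => top_at (next_bag B B1) l q' v
    | true :: q' => top_at B r q' v
    end
  else false.

Lemma top_at_vars B F q v : top_at B F q v -> v \in btree_vars F.
Proof.
elim: F B q => // B1 l IHl r IHr B [|[] q]; rewrite btree_vars_node !mem_cat /=.
- by move=> /andP[->].
- by move=> /IHr->; rewrite orbT.
- by move=> /IHl->; rewrite orbT.
Qed.

Lemma coherent_next B B1 F : coherent B1 F -> coherent (next_bag B B1) F.
Proof. by apply: eq_coherent => v; rewrite mem_next_bag. Qed.

Lemma top_at_notin B F q v : coherent B F -> top_at B F q v -> v \notin B.
Proof.
elim: F B q => // B1 l IHl r IHr B [|[] q] /= [c1 _ cl cr].
- by move=> /andP[].
- exact: IHr.
move=> tv; have := IHl _ _ (coherent_next B cl) tv; rewrite mem_next_bag.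
by apply: contra; apply: c1; rewrite mem_cat (top_at_vars tv) orbT.
Qed.

(** A topmost occurrence is outside [B]. By coherence such a variable does not occur both in the
    first child's subtree and among the later siblings, and once in [B1] it is not new further
    down. *)
Lemma top_at_unique B F q q' v :
  coherent B F -> top_at B F q v -> top_at B F q' v -> q = q'.
Proof.
elim: F B q q' => // B1 l IHl r IHr B q q' cF tq tq'.
have vB := top_at_notin cF tq; case: cF => c1 c2 cl cr.
have no_r x : v \in B1 ++ btree_vars l -> ~~ top_at B r x v.
  by move=> vU; apply: contra vB => /top_at_vars; exact: c2.
have no_l x : v \in B1 -> ~~ top_at (next_bag B B1) l x v.
  move=> vB1; apply/negP => /(top_at_notin (coherent_next B cl)).
  by rewrite mem_next_bag vB1.
have inl x : top_at (next_bag B B1) l x v -> v \in B1 ++ btree_vars l.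
  by move=> /top_at_vars vl; rewrite mem_cat vl orbT.
case: q q' tq tq' => [|[] q] [|[] q'] //=.
- by move=> /andP[vB1 _]; rewrite (negbTE (no_r _ _)) // mem_cat vB1.
- by move=> /andP[vB1 _]; rewrite (negbTE (no_l _ vB1)).
- by move=> + /andP[vB1 _]; rewrite (negbTE (no_r _ _)) // mem_cat vB1.
- by move=> t1 t2; rewrite (IHr _ _ _ cr t1 t2).
- by move=> + /inl vU; rewrite (negbTE (no_r _ vU)).
- by move=> + /andP[vB1 _]; rewrite (negbTE (no_l _ vB1)).
- by move=> /inl vU; rewrite (negbTE (no_r _ vU)).
- by move=> t1 t2; rewrite (IHl _ _ _ (coherent_next B cl) t1 t2).
Qed.

Lemma mem_local_cases X F B a z :
  z \in local_names X F B (nm a [::]) ->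
  (exists p, z = nm a p) \/ (exists b p, z = nm (b :: a) p) \/
  exists2 v, z = inp v & top_at B F [::] v.
Proof.
case: F => [|B1 l r] /=; first by move/pathsP => [p _ ->]; left; exists (p ++ [::]).
rewrite !nm_kid !mem_cat => /or4P[/pathsP[p _ ->]|/pathsP[p _ ->]|zt|].
- by left; exists (p ++ [::]).
- by right; left; exists true, (p ++ [::]).
- rewrite -mem_cat in zt.
  by have [p ->] := tree_pathsP zt; right; left; exists false, p.
case/mapP => v; rewrite mem_filter mem_next_bag => /andP[/andP[_ vB] vB1] ->.
by right; right; exists v; rewrite // vB1 vB.
Qed.

Lemma forest_tree_names psi X F B a q z :
  z \in bag_at (forest_tree psi X F B (nm a [::])) q ->
  exists2 bs, q = map nat_of_bool bs &
  (exists p, z = nm (catrev bs a) p) \/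
  (exists b p, z = nm (b :: catrev bs a) p) \/
  exists2 v, z = inp v & top_at B F bs v.
Proof.
elim: F B a q => [|B1 l IHl r IHr] B a [|i q].
- by move=> /mem_local_names/mem_local_cases H; exists [::].
- by rewrite /= nth_nil bag_at_empty.
- move=> zl; exists [::] => //; apply: mem_local_cases (mem_local_names _).
  exact: zl.
rewrite /= !nm_kid; case: i => [|[|i]] /=.
- by move=> /IHl[bs -> H]; exists (false :: bs).
- by move=> /IHr[bs -> H]; exists (true :: bs).
- by rewrite nth_nil bag_at_empty.
Qed.

Lemma is_child_rcons q i : is_child q (rcons q i).
Proof.
by rewrite /is_child size_rcons /= -cats1 take_size_cat // eqxx andbT; case: q.
Qed.

(** A gate name contains an address and occurs only in the bags at that address and at its parent,
    and an input occurs in one bag only. Hence two bags with a common variable are equal or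
    adjacent, and one edge suffices as a walk. *)
Lemma forest_tree_connected psi X F B z :
  coherent B F -> bags_connected (forest_tree psi X F B (nm [::] [::])) z.
Proof.
move=> cF p q /[dup] zp /forest_tree_names[bs Ep Hp].
move=> /[dup] zq /forest_tree_names[cs Eq Hq].
suff [E|[E|E]] : bs = cs \/ (exists b, bs = rcons cs b) \/ (exists b, cs = rcons bs b).
- by exists [::]; rewrite Ep Eq E.
- case: E => b E; exists [:: q]; rewrite /= zq Ep Eq E map_rcons.
  by rewrite /node_adj is_child_rcons orbT.
- case: E => b E; exists [:: q]; rewrite /= zq Ep Eq E map_rcons.
  by rewrite /node_adj is_child_rcons.
have rcons_eq (x y : seq bool) b : rev x = b :: rev y -> x = rcons y b.
  by move=> E; rewrite -[x]revK E rev_cons revK.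
have not_inp a s v : nm a s <> inp v.
  by move=> E; move: (nm_not_inp a s [:: v]); rewrite E mem_head.
rewrite -!/(rev _) in Hp Hq.
case: Hp => [[s ->]|[[b [s ->]]|[v -> tv]]] in Hq *;
  case: Hq => [[s' E]|[[b' [s' E]]|[v' E tv']]].
- by left; move/nm_inj: E => [/(can_inj revK)].
- by right; left; exists b'; apply: rcons_eq; have [] := nm_inj E.
- by case: (not_inp _ _ _ E).
- by right; right; exists b; apply: rcons_eq; have [] := nm_inj E.
- by left; move/nm_inj: E => [[_ /(can_inj revK)]].
- by case: (not_inp _ _ _ E).
- by case: (not_inp _ _ _ (esym E)).
- by case: (not_inp _ _ _ (esym E)).
- by left; case: E tv' => <-; exact: top_at_unique tv.
Qed.

Definition output_cnf psi X T : cnf :=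
  [:: (true, [::])] :: circuit_cnf (forest_gates psi X (lcrs T Leaf) [::] [::]).

Definition output_tree psi X T : bag_tree :=
  forest_tree psi X (lcrs T Leaf) [::] [::].

Lemma root_in_bags psi X F w :
  exists2 D, D \in bags (forest_tree psi X F [::] w) & w \in D.
Proof.
exists (bag_of (circuit_cnf (local_gates psi X F [::] w))).
  by case: F => *; exact: mem_head.
by rewrite mem_bag_circuit; apply/orP; left; apply: outs_local; exact: mem_head.
Qed.

Lemma output_clause_bag psi X T C :
  C \in output_cnf psi X T ->
  exists2 D, D \in bags (output_tree psi X T) & {subset clause_vars C <= D}.
Proof.
rewrite inE => /orP[/eqP->|]; last exact: forest_clause_bag.
have [D DT wD] := root_in_bags psi X (lcrs T Leaf) [::].
by exists D => // z; rewrite inE => /eqP->.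
Qed.

Lemma output_td psi X V E T :
  tree_decomposition V E T ->
  tree_decomposition (vars (output_cnf psi X T))
    (primal_edge (output_cnf psi X T)) (output_tree psi X T).
Proof.
move=> td; split.
- move=> D /forest_bags_sub DK z /DK; rewrite mem_undup => zK.
  by rewrite /= inE zK orbT.
- move=> z; rewrite mem_undup => /flattenP[Cv /mapP[C /output_clause_bag[D DT CD] ->]].
  by move=> /CD; exists D.
- move=> u v _ _ /andP[_ /hasP[C /output_clause_bag[D DT CD] /andP[/CD uD /CD vD]]].
  by exists D; rewrite // uD.
- move=> z _; exact: forest_tree_connected (td_coherent td).
Qed.

(** * The model count of the output *)

Definition restrict (V : seq var) (beta : var -> bool) : assignment V :=
  [ffun u => beta (val u)].

Lemma value_restrict V beta : {in V, value (restrict V beta) =1 beta}.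
Proof. by move=> z zV; rewrite /value insubT ffunE. Qed.

Lemma value_val V (a : assignment V) (u : seq_sub V) : value a (val u) = a u.
Proof. by rewrite /value valK. Qed.

Lemma eq_sat beta1 beta2 psi :
  {in vars psi, beta1 =1 beta2} -> sat beta1 psi = sat beta2 psi.
Proof.
move=> eqb; apply: eq_in_all => C Cpsi; apply: eq_in_has => l lC.
by rewrite eqb // (mem_vars Cpsi lC).
Qed.

Lemma projectedP psi X (a : assignment X) :
  {subset X <= vars psi} ->
  reflect (exists2 tau, {in X, forall x, tau x = value a x} & sat tau psi)
    [exists b : assignment (vars psi), extends b a && satisfies b psi].
Proof.
move=> XV; apply: (iffP existsP) => [[b /andP[/forallP ext sb]]|[tau tX ts]].
  exists (value b) => // x xX; have := ext (SeqSub xX) => /eqP /= ->.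
  by rewrite -value_val.
exists (restrict (vars psi) tau); apply/andP; split.
  apply/forallP => u; rewrite value_restrict; last exact: XV (valP u).
  by rewrite tX ?value_val // (valP u).
by rewrite /satisfies -/(sat _ _) (eq_sat (@value_restrict _ _)).
Qed.

Lemma output_count psi X T :
  {subset X <= vars psi} ->
  tree_decomposition (vars psi) (primal_edge psi) T ->
  projected_model_count psi X = model_count (output_cnf psi X T).
Proof.
move=> XV td; set G := forest_gates psi X (lcrs T Leaf) [::] [::].
have gG : grounded [in map inp X] G := grounded_forest psi X _ _ _.
pose V := vars (output_cnf psi X T).
(* Reading off the inputs is the bijection from the models of the output onto the extendable
   assignments of [X]. *)
pose r (b : assignment V) : assignment X := [ffun u => value b (inp (val u))].
have r_val b : {in X, forall x, value (r b) x = value b (inp x)}.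
  by move=> x xX; rewrite -[x]/(val (SeqSub xX)) value_val ffunE.
have satE beta : sat beta (output_cnf psi X T) = beta [::] && sat beta (circuit_cnf G).
  by rewrite /sat /= orbF eqb_id.
have inpV : {in X, forall x, inp x \in V}.
  move=> x xX; rewrite mem_undup /= inE; apply/orP; right; apply: inp_forest => //.
  rewrite /btree_vars btree_bags_lcrs; apply/flattenP.
  by have [_ cov _ _] := td; have [D] := cov x (XV x xX); exists D.
have Vcase z : z \in V -> (z \in map gate_out G) || (z \in map inp X).
  rewrite mem_undup /= inE => /orP[/eqP->|].
    apply/orP; left; apply: (@outs_forest psi X _ [::] [::]); exact: mem_head.
  rewrite -/(bag_of (circuit_cnf G)) mem_bag_circuit => /orP[->//|].
  exact: grounded_args gG.
rewrite /projected_model_count /model_count -/V.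
set M := [set b : assignment V | _].
have r_inj : {in M &, injective r}.
  move=> b1 b2; rewrite !inE /satisfies -!/(sat _ _) !satE.
  move=> /andP[_ s1] /andP[_ s2] /ffunP eqr.
  have eqi z : z \in map inp X -> value b1 z = value b2 z.
    by move=> /mapP[x xX ->]; have := eqr (SeqSub xX); rewrite !ffunE.
  apply/ffunP => u; rewrite -!value_val.
  by case/orP: (Vcase _ (valP u)) => [|/eqi//]; exact: circuit_unique gG eqi s1 s2 _.
rewrite -(card_in_imset r_inj); apply: eq_card => a; rewrite inE.
apply/(projectedP a XV)/imsetP => [[tau tX ts]|[b]]; last first.
  rewrite inE /satisfies -/(sat _ _) satE => /andP[b0 sb] ->.
  have [/(_ b0)[tau tX ts] _] := root_sem XV td sb.
  by exists tau => // x xX; rewrite tX // r_val.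
(* For surjectivity the circuit is evaluated on the inputs given by [a]; [behead] strips the letter
   that marks an input. *)
pose beta0 z := value a (behead z).
have [beta eqb sb] : exists2 beta : var -> bool,
    (forall z, z \in map inp X -> beta z = beta0 z) & sat beta (circuit_cnf G).
  apply: circuit_exists gG _ _; first exact: (@uniq_outs_forest psi X _ [::] [::]).
  move=> z /(@outs_forest_nm psi X _ [::] [::])[c [p [-> _]]].
  exact: nm_not_inp.
have betaX : {in X, forall x, beta (inp x) = value a x}.
  by move=> x xX; rewrite eqb ?map_f.
have beta_root : beta [::].
  have [_ H] := root_sem XV td sb; apply: H.
  by exists tau => // x xX; rewrite tX ?betaX.
exists (restrict V beta).
  rewrite inE /satisfies -/(sat _ _) (eq_sat (@value_restrict _ _)) satE.
  by rewrite beta_root.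
apply/ffunP => u; rewrite ffunE value_restrict ?inpV ?(valP u) //.
by rewrite betaX ?value_val ?(valP u).
Qed.

(** * Size of the output *)

(** A block has three letters, each of size at most three plus one for the list cell. *)
Lemma dsize_step b w : dsize (enc_var (step b w)) <= dsize (enc_var w) + 12.
Proof. by rewrite /=; case: b => /=; rewrite -/(enc_var w); lia. Qed.

Lemma dsize_kid b w : dsize (enc_var (kid b w)) <= dsize (enc_var w) + 12.
Proof. by rewrite /=; case: b => /=; rewrite -/(enc_var w); lia. Qed.

Lemma dsize_paths m w z :
  z \in paths m w -> dsize (enc_var z) <= dsize (enc_var w) + 12 * m.
Proof.
elim: m w => [|m IHm] w /=; first by rewrite inE => /eqP->; rewrite leq_addr.
rewrite mem_cat => /orP[] /IHm.
  by have := dsize_step false w; move: (dsize _) (dsize _) (dsize _); lia.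
by have := dsize_step true w; move: (dsize _) (dsize _) (dsize _); lia.
Qed.

Lemma dsize_inner_paths m w z :
  z \in inner_paths m w -> dsize (enc_var z) <= dsize (enc_var w) + 12 * m.
Proof.
elim: m w => [|m IHm] w //=.
rewrite inE mem_cat => /or3P[/eqP->|/IHm|/IHm]; first by rewrite leq_addr.
  by have := dsize_step false w; move: (dsize _) (dsize _) (dsize _); lia.
by have := dsize_step true w; move: (dsize _) (dsize _) (dsize _); lia.
Qed.

Lemma dsize_local_names n psi X F (B : seq var) w z :
  uniq B -> size B <= n -> {in btree_bags F, forall B1, size (undup B1) <= n} ->
  {in X, forall x, dsize (enc_var x) <= n} ->
  z \in bag_of (circuit_cnf (local_gates psi X F B w)) ->
  dsize (enc_var z) <= dsize (enc_var w) + 13 * n + 12.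
Proof.
move=> uB leB leF leX /mem_local_names; case: F leF => [|B1 l r] leF /=.
  by move=> /dsize_paths; move: (dsize _) (dsize _) => u v; nia.
have leN : size (next_bag B B1) <= n by rewrite size_next_bag // leF ?mem_head.
move: (next_bag B B1) leN => N leN; rewrite /tree_paths !mem_cat -orbA.
case/or4P => [/dsize_paths|/dsize_paths| |/orP[/dsize_paths|]].
- by move: (dsize _) (dsize _) => u v; nia.
- by have := dsize_kid true w; move: (dsize _) (dsize _) (dsize _) => u v t; nia.
- move=> /dsize_inner_paths; have := dsize_kid false w.
  by move: (dsize _) (dsize _) (dsize _) => u v t; nia.
- by have := dsize_kid false w; move: (dsize _) (dsize _) (dsize _) => u v t; nia.
case/mapP => v; rewrite mem_filter => /andP[/andP[/leX lev _] _] -> /=.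
by rewrite -/(enc_var v); lia.
Qed.

(** Each level of the tree lengthens a name by one block, and the depth is at most [btree_size F];
    the assignment part is bounded by the size of one bag. *)
Lemma dsize_forest_names n psi X F (B : seq var) w z :
  uniq B -> size B <= n -> {in btree_bags F, forall B1, size (undup B1) <= n} ->
  {in X, forall x, dsize (enc_var x) <= n} ->
  z \in bag_of (circuit_cnf (forest_gates psi X F B w)) ->
  dsize (enc_var z) <= dsize (enc_var w) + 12 * btree_size F + 13 * n.
Proof.
move=> + + + leX; elim: F B w => [|B1 l IHl r IHr] B w uB leB leF.
  rewrite [forest_gates _ _ _ _ _]/= cats0.
  move=> /(@dsize_local_names n psi X Leaf) H; have := H uB leB leF leX.
  by rewrite /=; move: (dsize _) (dsize _) => u v; lia.
have leN : size (next_bag B B1) <= n by rewrite size_next_bag // leF ?mem_head.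
have leFl : {in btree_bags l, forall B1, size (undup B1) <= n}.
  by move=> E El; apply: leF; rewrite inE mem_cat El orbT.
have leFr : {in btree_bags r, forall B1, size (undup B1) <= n}.
  by move=> E Er; apply: leF; rewrite inE mem_cat Er !orbT.
rewrite forest_gates_node circuit_cnf_cat bag_of_cat mem_cat => /orP[H|].
  have := dsize_local_names uB leB leF leX H.
  by rewrite /=; move: (dsize _) (dsize _) => u v; lia.
rewrite circuit_cnf_cat bag_of_cat mem_cat => /orP[H|H].
  have := IHl _ _ (uniq_next_bag B1 uB) leN leFl H; have := dsize_kid false w.
  by rewrite -[btree_size (Node _ _ _)]/(btree_size l + btree_size r).+1;
    move: (dsize _) (dsize _) (dsize _) => u v t; lia.
have := IHr _ _ uB leB leFr H; have := dsize_kid true w.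
by rewrite -[btree_size (Node _ _ _)]/(btree_size l + btree_size r).+1;
  move: (dsize _) (dsize _) (dsize _) => u v t; lia.
Qed.

Lemma dsize_clause L (C : clause) :
  {in clause_vars C, forall z, dsize (enc_var z) <= L} ->
  dsize (enc_seq enc_literal C) <= (size C * (L + 5)).+1.
Proof.
elim: C => //= -[b v] C IHC leC /=.
have lev : dsize (enc_var v) <= L by apply: leC; exact: mem_head.
have {}IHC := IHC (fun z zC => leC z (@mem_behead _ (v :: clause_vars C) z zC)).
have : dsize (enc_bool b) <= 3 by case: b {leC}.
by move: IHC lev; move: (dsize _) (dsize _) (dsize _) => p q t; nia.
Qed.

Lemma dsize_cnf L K :
  {in bag_of K, forall z, dsize (enc_var z) <= L} ->
  dsize (enc_cnf K) <= (2 * size K + size (flatten K) * (L + 5)).+1.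
Proof.
elim: K => //= C K IHK leK; rewrite -/(enc_cnf K) size_cat.
have leC : {in clause_vars C, forall z, dsize (enc_var z) <= L}.
  by move=> z zC; apply: leK; rewrite mem_cat zC.
have {}IHK : dsize (enc_cnf K) <= (2 * size K + size (flatten K) * (L + 5)).+1.
  by apply: IHK => z zK; apply: leK; rewrite mem_cat zK orbT.
by move: (dsize_clause leC) IHK; move: (dsize _) (dsize _) => p q; nia.
Qed.

(** A gate yields at most twelve literals of size [L + 5], counted with their list cells, and at
    most four clauses with an overhead of two each. *)
Lemma dsize_circuit L G :
  {in bag_of (circuit_cnf G), forall z, dsize (enc_var z) <= L} ->
  dsize (enc_cnf (circuit_cnf G)) <= (size G * (12 * L + 68)).+1.
Proof.
move=> /dsize_cnf/leq_trans; apply; rewrite ltnS.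
have := size_circuit_cnf G; have := leq_mul (size_flatten_circuit_cnf G) (leqnn (L + 5)).
by move: (size (flatten _)) (size (circuit_cnf _)) => p q; lia.
Qed.

Lemma dsize_bag_of K : dsize (enc_seq enc_var (bag_of K)) <= dsize (enc_cnf K).
Proof.
have clause (C : clause) s : dsize (enc_seq enc_var (clause_vars C ++ s)) <=
    dsize (enc_seq enc_literal C) + dsize (enc_seq enc_var s).
  elim: C => [|l C] /=; first by lia.
  rewrite -/(enc_var l.2); have := dsize_gt0 (enc_bool l.1).
  move: (dsize _) (dsize _) (dsize _) (dsize _) (dsize _).
  by move=> a b c d e; lia.
elim: K => //= C K IHK; rewrite -/(enc_cnf K).
by apply: leq_trans (clause _ _) _; rewrite -addnS leq_add2l leqW.
Qed.

Lemma size_forest_gates psi X F (B : seq var) w m :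
  uniq B -> size B <= m ->
  {in btree_bags F, forall B1, size (undup B1) <= m} ->
  size (forest_gates psi X F B w) <= btree_size F * (2 * 2 ^ m).
Proof.
elim: F B w => [|B1 l IHl r IHr] B w uB leB leF.
  rewrite [forest_gates _ _ _ _ _]/= cats0 mul1n.
  exact: (@size_local_gates psi X Leaf).
rewrite forest_gates_node size_cat (size_cat (forest_gates _ _ _ _ _)).
rewrite -[btree_size (Node _ _ _)]/(_ + _).+1 mulSn mulnDl.
apply: leq_add; first exact: size_local_gates.
apply: leq_add.
  apply: IHl; first exact: uniq_next_bag.
    by rewrite size_next_bag // leF ?mem_head.
  by move=> E El; apply: leF; rewrite inE mem_cat El orbT.
by apply: IHr => // E Er; apply: leF; rewrite inE mem_cat Er !orbT.
Qed.

Lemma dsize_forest_tree L psi X F (B : seq var) w m :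
  uniq B -> size B <= m ->
  {in btree_bags F, forall B1, size (undup B1) <= m} ->
  {in bag_of (circuit_cnf (forest_gates psi X F B w)),
    forall z, dsize (enc_var z) <= L} ->
  dsize (enc_bag_tree (forest_tree psi X F B w)) <=
  btree_size F * (2 * 2 ^ m * (12 * L + 68) + 6).
Proof.
have local F' (B' : seq var) w' : uniq B' -> size B' <= m ->
    {in btree_bags F', forall B1, size (undup B1) <= m} ->
    {in bag_of (circuit_cnf (local_gates psi X F' B' w')),
      forall z, dsize (enc_var z) <= L} ->
    dsize (enc_seq enc_var (bag_of (circuit_cnf (local_gates psi X F' B' w')))) <=
    (2 * 2 ^ m * (12 * L + 68)).+1.
  move=> uB leB leF leL; apply: leq_trans (dsize_bag_of _) _.
  apply: leq_trans (dsize_circuit leL) _.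
  by rewrite ltnS leq_mul2r size_local_gates ?orbT.
elim: F B w => [|B1 l IHl r IHr] B w uB leB leF leL.
  have: {in bag_of (circuit_cnf (local_gates psi X Leaf B w)),
      forall z, dsize (enc_var z) <= L}.
    by move=> z zK; apply: leL; rewrite /= cats0.
  move/(local _ _ _ uB leB leF); rewrite /= mul1n.
  by move: (dsize _) (2 * _ * _) => p q; lia.
have leN : size (next_bag B B1) <= m by rewrite size_next_bag // leF ?mem_head.
have leFl : {in btree_bags l, forall B1, size (undup B1) <= m}.
  by move=> E El; apply: leF; rewrite inE mem_cat El orbT.
have leFr : {in btree_bags r, forall B1, size (undup B1) <= m}.
  by move=> E Er; apply: leF; rewrite inE mem_cat Er !orbT.
move: leL; rewrite forest_gates_node circuit_cnf_cat bag_of_cat.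
rewrite (circuit_cnf_cat (forest_gates _ _ _ _ _)) bag_of_cat => leL.
have Hloc : dsize (enc_seq enc_var
      (bag_of (circuit_cnf (local_gates psi X (Node B1 l r) B w)))) <=
    (2 * 2 ^ m * (12 * L + 68)).+1.
  by apply: local => // z zK; apply: leL; rewrite mem_cat zK.
have Hl : dsize (enc_bag_tree (forest_tree psi X l (next_bag B B1) (kid false w))) <=
    btree_size l * (2 * 2 ^ m * (12 * L + 68) + 6).
  apply: IHl leN leFl _; first exact: uniq_next_bag.
  by move=> z zl; apply: leL; rewrite !mem_cat zl orbT.
have Hr : dsize (enc_bag_tree (forest_tree psi X r B (kid true w))) <=
    btree_size r * (2 * 2 ^ m * (12 * L + 68) + 6).
  apply: IHr uB leB leFr _ => z zr.
  by apply: leL; rewrite !mem_cat zr !orbT.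
rewrite -[btree_size (Node _ _ _)]/(btree_size l + btree_size r).+1.
rewrite -[forest_tree _ _ _ _ _]/(BagNode _ [:: _; _]).
rewrite [enc_bag_tree _]/= [dsize _]/=.
rewrite mulSn mulnDl; move: Hl Hr Hloc.
move: (2 * 2 ^ m * _) (_ * _) (_ * _) => p q t.
rewrite [local_gates _ _ _ _ _]/=.
move: (dsize _) (dsize _) (dsize _) => u v x; lia.
Qed.

Lemma btree_size_dsize F : btree_size F <= dsize (enc_btree F).
Proof.
elim: F => //= B l IHl r IHr; have := dsize_gt0 (enc_seq enc_var B).
by move: (dsize _) (dsize _) (dsize _) IHl IHr; lia.
Qed.

Lemma btree_bags_dsize F D :
  D \in btree_bags F -> dsize (enc_seq enc_var D) <= dsize (enc_btree F).
Proof.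
elim: F => //= B l IHl r IHr; rewrite inE mem_cat.
case/or3P => [/eqP->|/IHl|/IHr]; first by lia.
  by move: (dsize _) (dsize _) (dsize _) (dsize _); lia.
by move: (dsize _) (dsize _) (dsize _) (dsize _); lia.
Qed.

(** * The bounds for the whole algorithm *)

Lemma width_le T (k : nat) :
  (width T <= k%:Z)%R = (\max_(B <- bags T) size (undup B) <= k.+1).
Proof. by rewrite /width; lia. Qed.

Lemma runs_main n m psi X T :
  0 < n -> dsize (enc_cnf psi) <= n -> dsize (enc_seq enc_var X) <= n ->
  {in bags T, forall B, bounded n m B} ->
  runs 0 (enc_input psi X T) (enc_output (output_cnf psi X T) (output_tree psi X T))
    (btree_size (lcrs T Leaf) * (5000 * (2 ^ m * n ^ 3)) + 50).
Proof.
move=> n_gt0 lepsi leX leT.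
have b0 : bounded n m [::] by split.
have := @runs_forest n m psi X (lcrs T Leaf) [::] [::] [::] n_gt0 lepsi leX isT b0.
rewrite btree_bags_lcrs => /(_ leT).
have -> : enc_btree (lcrs T Leaf) = Pair (enc_bag_tree T) Nil := enc_lcrs [:: T].
rewrite cats0 => H; ev_start.
  do 2 ev_step; eapply ev_case_pair; first by repeat ev_step; exact: H.
  by repeat ev_step.
by lia.
Qed.

Theorem lemma10 :
  exists (P : program) (c d : nat),
  forall (psi : cnf) (X : seq var) (T : bag_tree) (k : nat),
    {subset X <= vars psi} ->
    tree_decomposition (vars psi) (primal_edge psi) T ->
    (width T <= k%:Z)%R ->
    exists (psi' : cnf) (T' : bag_tree),
      [/\ outputs_within P (enc_input psi X T) (enc_output psi' T')
            (c * 2 ^ k * dsize (enc_input psi X T) ^ d),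
          tree_decomposition (vars psi') (primal_edge psi') T',
          (width T' <= (12 * 2 ^ k)%:Z)%R
        & projected_model_count psi X = model_count psi'].
Proof.
(* At most [n] nodes at a cost of order [2 ^ k * n ^ 3] give the exponent 4. With [Q] for
   [2 ^ k * n ^ 4], the steps take at most [3 * 5000 * Q], and the last 5000 pays for writing the
   formula and the tree, at most [1600 * Q] each. *)
exists prog, (4 * 5000), 4 => psi X T k XV td; rewrite width_le => wT.
set n := dsize (enc_input psi X T); set F := lcrs T Leaf.
exists (output_cnf psi X T), (output_tree psi X T).
have szT : {in bags T, forall B, size (undup B) <= k.+1}.
  move=> B BT; apply: leq_trans wT.
  exact: (@leq_bigmax_seq _ (bags T) xpredT (fun B : seq var => size (undup B))).
have szF : {in btree_bags F, forall B, size (undup B) <= k.+1}.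
  by rewrite btree_bags_lcrs.
split; last exact: output_count; last first.
- rewrite width_le; apply/bigmax_leqP_seq => D DT _.
  (* Width [k] means bags of size at most [k.+1], so the new bags have at most [5 * 2 ^ k.+1], that
     is [10 * 2 ^ k], elements. *)
  have := @size_forest_bags psi X F [::] [::] k.+1 isT (leq0n _) szF D DT.
  by rewrite expnS; lia.
- exact: output_td td.
have [lepsi leX leF] : [/\ dsize (enc_cnf psi) <= n, dsize (enc_seq enc_var X) <= n
    & dsize (enc_btree F) <= n].
  have -> : enc_btree F = Pair (enc_bag_tree T) Nil := enc_lcrs [:: T].
  rewrite /n /enc_input /=; have := dsize_gt0 (enc_cnf psi).
  have := dsize_gt0 (enc_seq enc_var X).
  by move: (dsize _) (dsize _) (dsize _) => a b c; split; lia.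
have leB : {in btree_bags F, forall B, dsize (enc_seq enc_var B) <= n}.
  by move=> B /btree_bags_dsize/leq_trans; apply.
have n_gt0 : 0 < n := dsize_gt0 _.
have [|s run les] := @runs_main n k.+1 psi X T n_gt0 lepsi leX.
  by move=> B BT; split; [apply: leB; rewrite btree_bags_lcrs|exact: szT].
exists s; first exact: run.
have leFn : btree_size F <= n := leq_trans (btree_size_dsize F) leF.
have names : {in bag_of (circuit_cnf (forest_gates psi X F [::] [::])),
    forall z, dsize (enc_var z) <= 26 * n}.
  move=> z /(@dsize_forest_names n psi X F [::]) H.
  have /leq_trans -> // : dsize (enc_var z) <= 1 + 12 * btree_size F + 13 * n.
    apply: H => //.
      move=> B /leB; apply: leq_trans; apply: leq_trans (size_undup _) _.
      exact: ltnW (size_lt_dsize _ _).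
    by move=> x xX; apply: leq_trans leX; exact: dsize_mem.
  by lia.
set Q := 2 ^ k * n ^ 4; have Q_gt0 : 0 < Q by rewrite muln_gt0 !expn_gt0 n_gt0.
have leQ : 2 ^ k * (n * n) <= Q by rewrite leq_mul2l mulnn leq_pexp2l ?orbT.
have leQn : n <= Q.
  apply: leq_trans leQ; apply: (@leq_trans (n * n)); first by rewrite leq_pmulr.
  by rewrite leq_pmull ?expn_gt0.
have szG := @size_forest_gates psi X F [::] [::] k.+1 isT (leq0n _) szF.
have szK : dsize (enc_cnf (output_cnf psi X T)) <= 1600 * Q.
  (* There are at most [n * (4 * 2 ^ k)] gates; names of size at most [26 * n] make each of them
     cost at most [12 * (26 * n) + 68], hence [380 * n]. The unit clause for the root gate and the
     end of the list account for 9. *)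
  apply: (@leq_trans (9 + n * (4 * 2 ^ k) * (380 * n))); last first.
    by move: (2 ^ k) leQ => p leQ; lia.
  have := dsize_circuit names; rewrite /output_cnf /= -/(enc_cnf _) -/F.
  have : size (forest_gates psi X F [::] [::]) * (12 * (26 * n) + 68) <=
      n * (4 * 2 ^ k) * (380 * n).
    apply: leq_mul; last by lia.
    by apply: leq_trans szG _; rewrite expnS (mulnA 2 2) leq_mul.
  by move: (_ * _) (dsize _) => a b; lia.
have szO : dsize (enc_bag_tree (output_tree psi X T)) <= 1600 * Q.
  have := @dsize_forest_tree _ psi X F [::] [::] k.+1 isT (leq0n _) szF names.
  move/leq_trans; apply.
  apply: (@leq_trans (n * (4 * 2 ^ k * (380 * n) + 6))); last first.
    by move: (2 ^ k) leQ => p leQ; lia.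
  apply: leq_mul => //; rewrite leq_add2r; apply: leq_mul; last by lia.
  by rewrite expnS (mulnA 2 2).
have time : s <= 3 * 5000 * Q.
  apply: leq_trans les _.
  apply: (@leq_trans (n * (5000 * (2 ^ k.+1 * n ^ 3)) + 50)).
    by rewrite leq_add2r leq_mul2r leFn orbT.
  rewrite expnS; move: Q_gt0; rewrite /Q (expnS n 3).
  by move: (2 ^ k) (n ^ 3) => p q; lia.
rewrite -[4 * 5000 * _ * _]mulnA -/Q.
have -> : dsize (enc_output (output_cnf psi X T) (output_tree psi X T)) =
  (dsize (enc_cnf (output_cnf psi X T)) +
   dsize (enc_bag_tree (output_tree psi X T))).+1 by [].
move: szK szO time.
by move: (dsize (enc_cnf _)) (dsize (enc_bag_tree _)) => a b; lia.
Qed.
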